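(* Let $P, Q, R \in \mathbf{C}^{N\times N}$ be pairwise commuting matrices such that $Q$, $R$ and $R-Q$ are positive stable, and let $w\in\mathbf{R}\setminus\{0,-1\}$ be a real number. Then $${}_3F_2\left(P,\tfrac{Q}{2},\tfrac{Q+I}{2};\tfrac{R}{2},\tfrac{R+I}{2};\tfrac{1}{w+1}\right) = \left(\frac{w+1}{w}\right)^P \sum_{m=0}^\infty \binom{-P}{m} w^{-m}\; {}_3F_2\left(-mI,\tfrac{Q}{2},\tfrac{Q+I}{2};\tfrac{R}{2},\tfrac{R+I}{2};1\right).$$
   Context: $\mathbf{C}^{N\times N}$ is the space of complex $N\times N$ matrices, $I$ is the identity matrix, and $\mathbf{R}$ denotes the real numbers. A matrix $A\in\mathbf{C}^{N\times N}$ is positive stable if $\Re(\lambda)>0$ for every eigenvalue $\lambda$ of $A$. For a nonzero scalar $c$, $c^{A}=\exp(A\log c)$, with the principal logarithm. The matrix Pochhammer symbol is $(A)_0=I$, $(A)_m=A(A+I)\cdots(A+(m-1)I)$ for $m\ge 1$, and the matrix binomial coefficient is $\binom{-A}{m}=\frac{(-1)^m}{m!}(A)_m$. The generalized hypergeometric matrix function is defined by $${}_pF_q(P_1,\dots,P_p;Q_1,\dots,Q_q;z)=\sum_{m=0}^\infty \frac{(P_1)_m\cdots(P_p)_m(Q_1)_m^{-1}\cdots(Q_q)_m^{-1}}{m!}z^m,$$ where $P_i,Q_j\in\mathbf{C}^{N\times N}$ and each $Q_j+mI$ is invertible for all integers $m\ge 0$.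
   Formalization: The identity is asserted for those real w other than 0 and -1 at which both the left series and the outer right series converge (either may diverge otherwise, e.g. the right one for N=1, P=Q=1, R=2, w=1/2); convergence is proved for |w+1|>1 (left) and |w|>1 (right). *)

(* Defs.v *)
From HB Require Import structures.
From mathcomp Require Import all_boot all_order all_algebra.
From mathcomp Require Import all_classical all_reals all_analysis.
From mathcomp Require Export complex.

Set Implicit Arguments.
Unset Strict Implicit.
Unset Printing Implicit Defensive.

Import Order.TTheory GRing.Theory Num.Theory.
Import numFieldNormedType.Exports.

Local Open Scope ring_scope.
Local Open Scope complex_scope.

(* The topology of K[i] given by its modulus. It is not declared by the
   libraries, and it gives 'M[K[i]]_N its topology (entrywise convergence). *)
HB.instance Definition _ (K : realType) := NormedModule.copy K[i] K[i]^o.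

Section ComplexPower.
Variable K : realType.

(* The argument in ]-pi, pi]; the value at 0 is irrelevant. *)
Definition carg (z : K[i]) : K :=
  let t := acos (complex.Re z / complex.Re `|z|) in
  if 0 <= complex.Im z then t else - t.

Definition clog (z : K[i]) : K[i] := ln (complex.Re `|z|) +i* carg z.

End ComplexPower.

Section MatrixFunctions.
Variables (K : realType) (N : nat).
Implicit Types (A : 'M[K[i]]_N) (Ps Qs : seq 'M[K[i]]_N) (c z : K[i]).

Definition positive_stable A : Prop :=
  forall l : K[i], eigenvalue A l -> 0 < complex.Re l.

Definition mexp A : 'M[K[i]]_N :=
  limn (series (fun k : nat => k`!%:R^-1 *: A ^+ k)).

Definition mpow c A : 'M[K[i]]_N := mexp (clog c *: A).

Definition poch A (m : nat) : 'M[K[i]]_N := \prod_(k < m) (A + k%:R%:M).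

(* The argument is A for the binomial coefficient of - A over m. *)
Definition mbinN A (m : nat) : 'M[K[i]]_N := ((-1) ^+ m / m`!%:R) *: poch A m.

Definition pFq_term Ps Qs z (m : nat) : 'M[K[i]]_N :=
  (z ^+ m / m`!%:R) *:
    (\prod_(P <- Ps) poch P m *m \prod_(Q <- Qs) invmx (poch Q m)).

(* Meaningful only when every Q + m%:R%:M (Q in Qs) is invertible and the
   series converges. *)
Definition pFq Ps Qs z : 'M[K[i]]_N := limn (series (pFq_term Ps Qs z)).

End MatrixFunctions.

(* Main.v *)
(* Write c_k for the product of the Pochhammer quotients of Q/2, (Q+I)/2 by R/2,
   (R+I)/2, so that the left-hand side is F(z) = sum_k (P)_k / k! c_k z^k with
   z = 1/(w+1).  The inner series on the right is the binomial transform
   a_m = sum_k (-1)^k C(m,k) c_k, so that the right-hand sum is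
   G(t) = sum_m (P)_m / m! a_m (-t)^m with t = 1/w = z/(1-z).
   If 0 <= r < 1, expanding a_m and summing over m - k first turns
   sum_m (P)_m / m! a_m r^m into (1-r)^(-P) sum_k (P)_k / k! c_k (-r/(1-r))^k; the
   double series converges absolutely when the right-hand side does, and Abel's
   theorem covers the boundary.  The case w < -1 is r = -t; the case w > 0 is
   r = z with the roles of a and c exchanged, as the transform is an involution.
   For -1 < w < 0 we have z > 1, and as k! (P+n)_k^-1 and c_k^-1 grow
   subexponentially, convergence of F(z) forces (P)_n = 0 for some n; on each
   eigenspace of P the formula is then a finite polynomial identity.
   For the convergence of G, the differences of (A)_k (B)_k^-1 have the closed
   form (A)_k (B-A)_j (B)_(j+k)^-1, and the Leibniz rule writes a_m as a sum of
   such terms without cancellation, which grows subexponentially. *)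
From HB Require Import structures.
Require Import Defs.
From mathcomp Require Import all_boot all_order all_algebra.
From mathcomp Require Import all_classical all_reals all_analysis.
From mathcomp Require Import ring lra zify.

Import Order.TTheory GRing.Theory Num.Theory.
Import numFieldNormedType.Exports.

Local Open Scope ring_scope.
Local Open Scope complex_scope.

Set Implicit Arguments.
Unset Strict Implicit.
Unset Printing Implicit Defensive.

(** * An entrywise norm with real values *)

Section L1Norm.
Variable K : realType.
Implicit Types (x y : K) (z u : K[i]).

Definition l1c z : K := `|complex.Re z| + `|complex.Im z|.

Lemma l1c_ge0 z : 0 <= l1c z.
Proof. by rewrite addr_ge0. Qed.

Lemma l1c0 : l1c 0 = 0.
Proof. by rewrite /l1c /= normr0 addr0. Qed.

Lemma l1cN z : l1c (- z) = l1c z.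
Proof. by case: z => a b; rewrite /l1c /= !normrN. Qed.

Lemma l1cD z u : l1c (z + u) <= l1c z + l1c u.
Proof.
case: z u => [a b] [c d]; rewrite /l1c /= addrACA.
by rewrite lerD ?ler_normD.
Qed.

Lemma l1cM z u : l1c (z * u) <= l1c z * l1c u.
Proof.
case: z u => [a b] [c d]; rewrite /l1c /=.
have h1 := ler_normB (a * c) (b * d); have h2 := ler_normD (a * d) (b * c).
rewrite !normrM in h1 h2; lra.
Qed.

Lemma l1cZ x z : l1c (x%:C * z) = `|x| * l1c z.
Proof. by case: z => a b; rewrite /l1c /= !mul0r subr0 addr0 !normrM mulrDr. Qed.

Lemma l1c_eq0 z : l1c z = 0 -> z = 0.
Proof.
case: z => a b; rewrite /l1c /= => /eqP; rewrite paddr_eq0 // !normr_eq0.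
by case/andP=> /eqP -> /eqP ->.
Qed.

Lemma normc_le_l1c z : `|z| <= (l1c z)%:C.
Proof.
rewrite [z in `|z|]complexE (le_trans (ler_normD _ _)) // normrM.
rewrite rmorphD /= !normc_def /= ?expr0n ?expr1n /= ?addr0 ?add0r ?sqrtr1 ?mul1r.
by rewrite !sqrtr_sqr.
Qed.

Lemma l1c_le_normc z : l1c z <= 2 * complex.Re `|z|.
Proof.
case: z => a b; rewrite normc_def /l1c /=.
have h x y : `|x| <= Num.sqrt (x ^+ 2 + y ^+ 2).
  by rewrite -sqrtr_sqr ler_wsqrtr // lerDl sqr_ge0.
have := h a b; have := h b a; rewrite [b ^+ 2 + _]addrC; lra.
Qed.

Definition l1 m n (A : 'M[K[i]]_(m, n)) : K := \sum_i \sum_j l1c (A i j).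

Section Rectangular.
Variables m n : nat.
Implicit Types A B : 'M[K[i]]_(m, n).

Lemma l1_ge0 A : 0 <= l1 A.
Proof. by do 2![apply: sumr_ge0 => ? _]; exact: l1c_ge0. Qed.

Lemma l10 : l1 (0 : 'M[K[i]]_(m, n)) = 0.
Proof. by rewrite /l1; do 2![apply: big1 => ? _]; rewrite mxE l1c0. Qed.

Lemma l1N A : l1 (- A) = l1 A.
Proof. by rewrite /l1; do 2![apply: eq_bigr => ? _]; rewrite mxE l1cN. Qed.

Lemma l1D A B : l1 (A + B) <= l1 A + l1 B.
Proof.
rewrite /l1 -big_split /=; apply: ler_sum => a _.
by rewrite -big_split /=; apply: ler_sum => b _; rewrite mxE l1cD.
Qed.

Lemma l1B A B : l1 (A - B) <= l1 A + l1 B.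
Proof. by rewrite (le_trans (l1D _ _)) // l1N. Qed.

Lemma l1_distC A B : l1 (A - B) = l1 (B - A).
Proof. by rewrite -l1N opprB. Qed.

Lemma l1Z x A : l1 (x%:C *: A) = `|x| * l1 A.
Proof.
rewrite /l1 mulr_sumr; apply: eq_bigr => a _.
by rewrite mulr_sumr; apply: eq_bigr => b _; rewrite mxE l1cZ.
Qed.

Lemma l1_sum I (s : seq I) (P : pred I) (F : I -> 'M[K[i]]_(m, n)) :
  l1 (\sum_(i <- s | P i) F i) <= \sum_(i <- s | P i) l1 (F i).
Proof.
apply: (big_ind2 (fun A x => l1 A <= x)) => //; first by rewrite l10.
by move=> A x B y hA hB; rewrite (le_trans (l1D _ _)) // lerD.
Qed.

Lemma l1c_le_l1 A a b : l1c (A a b) <= l1 A.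
Proof.
have ge0 a' b' : 0 <= l1c (A a' b') by exact: l1c_ge0.
rewrite /l1 (bigD1 a) //= (bigD1 b) //= -addrA lerDl.
by rewrite addr_ge0 ?sumr_ge0 // => ? _; rewrite sumr_ge0.
Qed.

Lemma l1_eq0 A : l1 A = 0 -> A = 0.
Proof.
move=> A0; apply/matrixP => a b; rewrite mxE; apply: l1c_eq0.
by apply: le_anti; rewrite l1c_ge0 -A0 l1c_le_l1.
Qed.

Lemma norm_le_l1 A : `|A| <= (l1 A)%:C.
Proof.
rewrite -[`|A|]/(mx_norm A); have [->|/mx_norm_neq0[[a b] ->]] /= :=
  eqVneq (mx_norm A) 0; first by rewrite lecR l1_ge0.
by rewrite (le_trans (normc_le_l1c _)) // lecR l1c_le_l1.
Qed.

Lemma l1_le_norm A : l1 A <= (m * n)%:R * (2 * complex.Re `|A|).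
Proof.
set b := 2 * _.
have -> : (m * n)%:R * b = \sum_(i < m) \sum_(j < n) b.
  by rewrite sumr_const sumr_const !card_ord -mulrnA mulnC mulr_natl.
apply: ler_sum => i _; apply: ler_sum => j _; rewrite /b.
rewrite (le_trans (l1c_le_normc _)) // ler_pM2l //.
suff : `|A i j| <= `|A| by rewrite !normc_def lecE /= => /andP[].
rewrite -[`|A|]/(mx_norm A) mx_normE.
rewrite -[leLHS]nngE num_le.
exact: (le_bigmax _ (fun ij : 'I_m * 'I_n => `|A ij.1 ij.2|%:nng) (i, j)).
Qed.

End Rectangular.

Lemma l1M m n p (A : 'M[K[i]]_(m, n)) (B : 'M[K[i]]_(n, p)) :
  l1 (A *m B) <= l1 A * l1 B.
Proof.
rewrite /l1 mulr_suml; apply: ler_sum => a _.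
apply: (@le_trans _ _ (\sum_b \sum_j l1c (A a j) * l1c (B j b))).
  apply: ler_sum => b _; rewrite mxE.
  apply: (big_ind2 (fun z x => l1c z <= x)) => [|z x u y hz hu|j _].
  - by rewrite l1c0.
  - by rewrite (le_trans (l1cD _ _)) // lerD.
  - exact: l1cM.
rewrite exchange_big mulr_suml; apply: ler_sum => j _.
rewrite -mulr_sumr ler_wpM2l ?l1c_ge0 // [leRHS](bigD1 j) //= lerDl.
by apply: sumr_ge0 => ? _; apply: sumr_ge0 => ? _; exact: l1c_ge0.
Qed.

End L1Norm.

Section MatrixConvergence.
Variables (K : realType) (N : nat).
Local Notation M := 'M[K[i]]_N.
Implicit Types (u v x : nat -> M) (A B L : M) (b c : nat -> K).

Local Open Scope classical_set_scope.

Definition mcvg u L := (fun n => l1 (u n - L)) @ \oo --> (0 : K).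

Lemma cvg_mcvg u L : u @ \oo --> L <-> mcvg u L.
Proof.
split=> [/cvgrPdist_lt uL|/cvgrPdist_lt uL].
- apply/cvgrPdist_lt => e e0.
  pose d := e / (1 + (N * N)%:R * 2).
  have D0 : 0 < 1 + (N * N)%:R * 2 :> K by rewrite ltr_wpDr // mulr_ge0.
  have d0 : 0 < d by rewrite divr_gt0.
  have /uL : 0 < d%:C by rewrite ltcR.
  apply: filterS => n; rewrite sub0r normrN ger0_norm ?l1_ge0 // l1_distC => h.
  have : complex.Re `|L - u n| < d by move: h; rewrite ltcE /= => /andP[].
  have R0 : 0 <= complex.Re `|L - u n|.
    by have : 0 <= `|L - u n| by []; rewrite lecE /= => /andP[].
  move=> hd; apply: le_lt_trans (l1_le_norm _) _; rewrite mulrA.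
  move: hd; rewrite /d ltr_pdivlMr // => hd.
  by apply: le_lt_trans hd; rewrite mulrC ler_wpM2l // lerDr.
- apply/cvgrPdist_lt => -[e e'] /[!ltcE] /= /andP[/eqP -> e0].
  apply: filterS (uL e e0) => n; rewrite sub0r normrN ger0_norm ?l1_ge0 //.
  rewrite l1_distC => h; apply: le_lt_trans (norm_le_l1 _) _.
  by rewrite ltcE /= eqxx h.
Qed.

Lemma mcvg_squeeze u L b : (forall n, l1 (u n - L) <= b n) ->
  b @ \oo --> (0 : K) -> mcvg u L.
Proof.
move=> ub b0; apply: squeeze_cvgr (cvg_cst _) b0.
by apply: nearW => n; rewrite l1_ge0 /=.
Qed.

Lemma mcvg_unique u L A : mcvg u L -> mcvg u A -> L = A.
Proof.
move=> /cvg_mcvg uL /cvg_mcvg uA.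
exact: (cvg_unique (@norm_hausdorff _ _)) uL uA.
Qed.

Lemma mcvg_lim u L : mcvg u L -> limn u = L.
Proof. by move=> /cvg_mcvg; apply: cvg_lim; exact: norm_hausdorff. Qed.

Lemma mcvg_cvgn u L : mcvg u L -> cvgn u.
Proof. by move=> /cvg_mcvg uL; apply/cvg_ex; exists L. Qed.

Lemma cvgn_mcvg u : cvgn u -> mcvg u (limn u).
Proof. by move=> ?; exact/cvg_mcvg. Qed.

Lemma mcvg_eq u v L : u =1 v -> mcvg u L -> mcvg v L.
Proof. by move=> /funext ->. Qed.

Lemma mcvg_cst A : mcvg (fun=> A) A.
Proof. by rewrite /mcvg subrr l10; exact: cvg_cst. Qed.

Lemma mcvg_near u L A : (\forall n \near \oo, u n = A) -> mcvg u L -> L = A.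
Proof.
move=> uA uL; apply: mcvg_unique uL _; apply: cvg_near_cst.
by apply: filterS uA => n ->; rewrite subrr l10.
Qed.

Lemma mcvgP u L : mcvg u L <->
  forall e : K, 0 < e -> exists n0, forall n, (n0 <= n)%N -> l1 (u n - L) <= e.
Proof.
split=> [/cvgrPdist_le uL e e0|uL].
  have [n0 _ h] := uL e e0; exists n0 => n n0n.
  by have := h n n0n; rewrite sub0r normrN ger0_norm ?l1_ge0.
apply/cvgrPdist_le => e e0; have [n0 h] := uL e e0.
by exists n0 => // n /h; rewrite /= sub0r normrN ger0_norm ?l1_ge0.
Qed.

Lemma mcvg_comp u L (h : nat -> nat) :
  (forall m, exists n0, forall n, (n0 <= n)%N -> (m <= h n)%N) ->
  mcvg u L -> mcvg (u \o h) L.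
Proof.
move=> hn /mcvgP uL; apply/mcvgP => e /uL[m mP]; have [n0 n0P] := hn m.
by exists n0 => n /n0P; exact: mP.
Qed.

Lemma mcvg_le u L A (b : K) :
  (\forall n \near \oo, l1 (u n - A) <= b) -> mcvg u L -> l1 (L - A) <= b.
Proof.
move=> [n1 _ ub] /mcvgP uL; apply/ler_addgt0Pr => e /uL[n0 n0P].
rewrite -(subrKA (u (maxn n0 n1))) (le_trans (l1D _ _)) // addrC lerD //.
  by apply: ub; rewrite /= leq_maxr.
by rewrite l1_distC n0P ?leq_maxl.
Qed.

Lemma mcvg_bounded u L : mcvg u L -> exists2 C, 0 <= C & forall n, l1 (u n) <= C.
Proof.
move=> /mcvgP/(_ 1 ltr01)[n0 n0P].
have s0 m : 0 <= \sum_(k < m) l1 (u k) by apply: sumr_ge0 => k _; exact: l1_ge0.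
exists (\sum_(k < n0) l1 (u k) + (1 + l1 L)); first by rewrite !addr_ge0 ?l1_ge0.
move=> n; have [n0n|nn0] := leqP n0 n.
  rewrite -[u n](subrK L) (le_trans (l1D _ _)) // -[leLHS]add0r.
  by rewrite lerD // lerD // n0P.
rewrite -[leLHS]addr0 lerD ?addr_ge0 ?l1_ge0 //.
by rewrite (bigD1 (Ordinal nn0)) //= lerDl sumr_ge0 // => k _; exact: l1_ge0.
Qed.

Lemma mcvgD u v A B : mcvg u A -> mcvg v B -> mcvg (fun n => u n + v n) (A + B).
Proof.
move=> uA vB; apply: (@mcvg_squeeze _ _ (fun n => l1 (u n - A) + l1 (v n - B))).
  by move=> n; rewrite opprD addrACA l1D.
by rewrite -[X in _ --> X](addr0 0); exact: cvgD.
Qed.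

Lemma mcvg_sum I (s : seq I) (u : I -> nat -> M) (A : I -> M) :
  (forall k, mcvg (u k) (A k)) ->
  mcvg (fun n => \sum_(k <- s) u k n) (\sum_(k <- s) A k).
Proof.
move=> uA; elim: s => [|k s ih].
  by rewrite big_nil; apply: mcvg_eq (mcvg_cst 0) => n; rewrite big_nil.
rewrite big_cons; apply: mcvg_eq (mcvgD (uA k) ih) => n.
by rewrite big_cons.
Qed.

Lemma mcvgM u v A B : mcvg u A -> mcvg v B -> mcvg (fun n => u n *m v n) (A *m B).
Proof.
move=> uA vB.
apply: (@mcvg_squeeze _ _
  (fun n => l1 (u n - A) * (l1 (v n - B) + l1 B) + l1 A * l1 (v n - B))).
  move=> n; have -> : u n *m v n - A *m B
      = (u n - A) *m ((v n - B) + B) + A *m (v n - B).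
    by rewrite subrK mulmxBl mulmxBr subrKA.
  rewrite (le_trans (l1D _ _)) // lerD ?l1M // (le_trans (l1M _ _)) //.
  by rewrite ler_wpM2l ?l1_ge0 // l1D.
have -> : (0 : K) = 0 * (0 + l1 B) + l1 A * 0 by rewrite mul0r mulr0 addr0.
apply: cvgD; last by apply: cvgM => //; exact: cvg_cst.
by apply: cvgM => //; apply: cvgD => //; exact: cvg_cst.
Qed.

Lemma mcvgMl u A B : mcvg u A -> mcvg (fun n => B *m u n) (B *m A).
Proof. by move=> uA; exact: mcvgM (mcvg_cst B) uA. Qed.

Lemma mcvgMr u A B : mcvg u A -> mcvg (fun n => u n *m B) (A *m B).
Proof. by move=> uA; exact: mcvgM uA (mcvg_cst B). Qed.

Lemma mcvgZ b (y : K) u A : b @ \oo --> y -> mcvg u A ->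
  mcvg (fun n => (b n)%:C *: u n) (y%:C *: A).
Proof.
move=> bx uA.
have h n : (b n)%:C *: u n = (b n)%:C%:M *m u n by rewrite mul_scalar_mx.
apply: mcvg_eq (fun n => esym (h n)) _; rewrite -mul_scalar_mx.
apply: mcvgM uA.
apply: (@mcvg_squeeze _ _ (fun n => `|b n - y| * l1 (1%:M : M))).
  by move=> n; rewrite -raddfB -rmorphB /= -[X in l1 X]scalemx1 l1Z.
rewrite -(mul0r (l1 (1%:M : M))); apply: cvgM; last exact: cvg_cst.
by apply/norm_cvg0P/subr_cvg0.
Qed.

Lemma mcvgZl (z : K[i]) u A : mcvg u A -> mcvg (fun n => z *: u n) (z *: A).
Proof.
move=> uA; rewrite -mul_scalar_mx.
by apply: mcvg_eq (mcvgMl z%:M uA) => n; rewrite mul_scalar_mx.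
Qed.

Lemma cvg0_sum I (s : seq I) (f : I -> nat -> K) :
  (forall k, f k @ \oo --> (0 : K)) ->
  \sum_(k <- s) f k n @[n --> \oo] --> (0 : K).
Proof.
move=> f0; elim: s => [|k s ih].
  by under eq_fun do rewrite big_nil; exact: cvg_cst.
under eq_fun do rewrite big_cons.
by have := cvgD (f0 k) ih; rewrite addr0; apply.
Qed.

Lemma mcvg_entries u L :
  (forall (a c : 'I_N), complex.Re (u n a c) @[n --> \oo] --> complex.Re (L a c)) ->
  (forall (a c : 'I_N), complex.Im (u n a c) @[n --> \oo] --> complex.Im (L a c)) ->
  mcvg u L.
Proof.
move=> uR uI; rewrite /mcvg /l1.
apply: cvg0_sum => a; apply: cvg0_sum => c.
rewrite -(addr0 (0 : K)).
apply: cvgD.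
  have -> : (fun n => `|complex.Re ((u n - L) a c)|) =
      (fun n => `|complex.Re (u n a c) - complex.Re (L a c)|).
    by apply/funext => n; rewrite !mxE; case: (u n a c) (L a c) => ? ? [].
  by apply/norm_cvg0P/subr_cvg0.
have -> : (fun n => `|complex.Im ((u n - L) a c)|) =
    (fun n => `|complex.Im (u n a c) - complex.Im (L a c)|).
  by apply/funext => n; rewrite !mxE; case: (u n a c) (L a c) => ? ? [].
by apply/norm_cvg0P/subr_cvg0.
Qed.

Lemma is_mcvg_series_le x b : (forall k, l1 (x k) <= b k) -> cvgn (series b) ->
  mcvg (series x) (limn (series x)).
Proof.
move=> xb cb; suff [L xL] : exists L, mcvg (series x) L.
  by rewrite (mcvg_lim xL).
have b0 k : 0 <= b k by rewrite (le_trans (l1_ge0 (x k))).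
have key (f : K[i] -> K) (i j : 'I_N) : (forall z, `|f z| <= l1c z) ->
    cvgn (series (fun k => f (x k i j))).
  move=> fl; apply: normed_cvg; apply: series_le_cvg cb => [k|//|k] /=.
    exact: normr_ge0.
  by rewrite (le_trans (fl _)) // (le_trans (l1c_le_l1 _ _ _)).
have cR i j := key _ i j (fun z => ler_wpDr (normr_ge0 (complex.Im z)) (lexx _)).
have cI i j := key _ i j (fun z => ler_wpDl (normr_ge0 (complex.Re z)) (lexx _)).
exists (\matrix_(i, j) (limn (series (fun k => complex.Re (x k i j))) +i*
                        limn (series (fun k => complex.Im (x k i j))))).
apply: mcvg_entries => i j; rewrite mxE /=.
  suff -> : (fun n => complex.Re (series x n i j)) =
    series (fun k => complex.Re (x k i j)) by exact: cR.
  apply/funext => n; rewrite /series /= summxE.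
  by elim/big_ind2: _ => // -[? ?] ? [? ?] ? /= <- <-.
suff -> : (fun n => complex.Im (series x n i j)) =
  series (fun k => complex.Im (x k i j)) by exact: cI.
apply/funext => n; rewrite /series /= summxE.
by elim/big_ind2: _ => // -[? ?] ? [? ?] ? /= <- <-.
Qed.

Lemma mcvg_series_bounded x L : mcvg (series x) L ->
  exists2 C, 0 <= C & forall k, l1 (x k) <= C.
Proof.
move=> /mcvg_bounded[C C0 xC]; exists (C + C); first exact: addr_ge0.
by move=> k; rewrite -seriesSB (le_trans (l1B _ _)) // lerD.
Qed.

Lemma series_tail b e : (forall k, 0 <= b k) -> cvgn (series b) -> 0 < e ->
  exists k0, forall n, (k0 <= n)%N -> \sum_(k0 <= k < n) b k <= e.
Proof.
move=> b0 cb e0; have ndb : nondecreasing_seq (series b).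
  by apply: nondecreasing_series => k _ _.
have := cb; move/cvgrPdist_le => /(_ e e0)[k0 _ k0P].
exists k0 => n k0n; have := k0P k0 (leqnn _); rewrite /= => h.
have := nondecreasing_cvgn_le ndb cb n => h'.
have -> : \sum_(k0 <= k < n) b k = series b n - series b k0.
  by rewrite sub_series k0n.
have := ler_norm (limn (series b) - series b k0); lra.
Qed.

(* Tannery's theorem *)
Lemma mcvg_dominated_sum (y : nat -> nat -> M) (Y : nat -> M) b (h : nat -> nat) :
  (forall n, (n <= h n)%N) -> (forall k n, l1 (y k n) <= b k) ->
  (forall k, mcvg (y k) (Y k)) -> cvgn (series b) ->
  mcvg (fun n => \sum_(0 <= k < h n) y k n) (limn (series Y)).
Proof.
move=> hn yb yY cb.
have b0 k : 0 <= b k by rewrite (le_trans (l1_ge0 (y k 0))).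
have Yb k : l1 (Y k) <= b k.
  rewrite -[Y k]subr0; apply: mcvg_le (yY k).
  by apply: nearW => n; rewrite subr0.
have YS := is_mcvg_series_le Yb cb; set S := limn (series Y) in YS *.
apply/mcvgP => e e0; have e3 : 0 < e / 3 by rewrite divr_gt0.
have [k0 k0P] := series_tail b0 cb e3.
have /mcvgP/(_ _ e3)[n0 n0P] := mcvg_sum (index_iota 0 k0) yY.
have tail (z : nat -> M) n : (forall k, l1 (z k) <= b k) -> (k0 <= n)%N ->
    l1 (\sum_(k0 <= k < n) z k) <= e / 3.
  by move=> zb k0n; rewrite (le_trans (l1_sum _ _ _)) //
    (le_trans _ (k0P n k0n)) // ler_sum.
exists (maxn k0 n0) => n; rewrite geq_max => /andP[k0n n0n].
have k0h := leq_trans k0n (hn n).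
have St : l1 (S - series Y k0) <= e / 3.
  apply: mcvg_le YS; exists k0 => // m k0m.
  by rewrite sub_series k0m; exact: tail.
rewrite (big_cat_nat (leq0n _) k0h) //= [X in X - S]addrC.
have -> (A B : M) : A + B - S = (A - (S - series Y k0)) + (B - series Y k0).
  by rewrite opprB addrACA [series Y k0 - S]addrC addrK.
have := n0P n n0n; have := tail (fun k => y k n) _ (fun k => yb k n) k0h.
move=> h1 h2; rewrite (le_trans (l1D _ _)) // (le_trans (lerD (l1B _ _) h2)) //.
move: h1 St; lra.
Qed.

(* Summation by parts bounds the difference by
   (1 - r) * (finitely many terms) + e. *)
Lemma abel_bound x S e : mcvg (series x) S -> 0 < e ->
  exists2 C, 0 <= C & forall (r : K) F, 0 <= r < 1 ->
    mcvg (series (fun k => (r ^+ k)%:C *: x k)) F -> l1 (F - S) <= (1 - r) * C + e.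
Proof.
move=> xS e0; pose d n := series x n - S.
have [B B0 dB] : exists2 C, 0 <= C & forall n, l1 (d n) <= C.
  have [C C0 xC] := mcvg_bounded xS; exists (C + l1 S).
    by rewrite addr_ge0 ?l1_ge0.
  by move=> n; rewrite (le_trans (l1B _ _)) // lerD.
have [n0 n0P] : exists n0, forall n, (n0 <= n)%N -> l1 (d n) <= e / 2.
  by move/mcvgP: xS; apply; rewrite divr_gt0.
exists (n0%:R * B); first by rewrite mulr_ge0.
move=> r F /andP[r0 r1] rF.
have parts n : series (fun k => (r ^+ k)%:C *: x k) n - S =
    (r ^+ n)%:C *: d n + \sum_(0 <= k < n) (r ^+ k * (1 - r))%:C *: d k.+1.
  elim: n => [|n ih].
    by rewrite /series /= !big_geq // /d /series /= big_geq // scale1r addr0.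
  have xd : x n = d n.+1 - d n by rewrite /d opprB addrA subrK seriesSB.
  rewrite seriesSr addrAC ih big_nat_recr //= [RHS]addrCA -addrA [LHS]addrCA xd.
  congr (_ + _); rewrite -scalerDr -scalerDl addrC subrK -rmorphD /=.
  by congr (_ *: _); congr (_%:C); rewrite exprS; ring.
have geo n : \sum_(0 <= k < n) (r ^+ k * (1 - r)) <= 1.
  suff -> : \sum_(0 <= k < n) (r ^+ k * (1 - r)) = 1 - r ^+ n.
    by rewrite gerBl exprn_ge0.
  elim: n => [|n ih]; first by rewrite big_geq // expr0 subrr.
  by rewrite big_nat_recr //= ih exprS; ring.
have r1' : 0 <= 1 - r by rewrite subr_ge0 ltW.
have w0 k : 0 <= r ^+ k * (1 - r) by rewrite mulr_ge0 ?exprn_ge0.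
apply: mcvg_le rF; exists n0 => // n n0n.
rewrite parts (le_trans (l1D _ _)) // l1Z ger0_norm ?exprn_ge0 //.
have h1 : r ^+ n * l1 (d n) <= e / 2.
  rewrite (le_trans _ (n0P n n0n)) // -[leRHS]mul1r ler_wpM2r ?l1_ge0 //.
  by rewrite exprn_ile1 // ltW.
rewrite (big_cat_nat (leq0n _) n0n) //=.
have h2 : l1 (\sum_(0 <= k < n0) (r ^+ k * (1 - r))%:C *: d k.+1) <= (1 - r) * (n0%:R * B).
  rewrite (le_trans (l1_sum _ _ _)) // mulr_natl mulrnAr -[n0 in leRHS]subn0.
  rewrite -sumr_const_nat ler_sum // => k _.
  rewrite l1Z ger0_norm // ler_pM ?l1_ge0 //.
  by rewrite -[leRHS]mul1r ler_wpM2r // exprn_ile1 // ltW.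
have h3 : l1 (\sum_(n0 <= k < n) (r ^+ k * (1 - r))%:C *: d k.+1) <= e / 2.
  apply: (@le_trans _ _ (\sum_(n0 <= k < n) (r ^+ k * (1 - r)) * (e / 2))).
    rewrite (le_trans (l1_sum _ _ _)) // big_nat [leRHS]big_nat.
    apply: ler_sum => k /andP[n0k _].
    by rewrite l1Z ger0_norm // ler_wpM2l // n0P // ltnW.
  rewrite -mulr_suml -[leRHS]mul1r ler_wpM2r ?divr_ge0 ?(ltW e0) //.
  rewrite (le_trans _ (geo n)) // [leRHS](big_cat_nat (leq0n _) n0n) //= lerDr.
  by apply: sumr_ge0 => k _.
have := l1D (\sum_(0 <= k < n0) (r ^+ k * (1 - r))%:C *: d k.+1)
  (\sum_(n0 <= k < n) (r ^+ k * (1 - r))%:C *: d k.+1).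
move: h1 h2 h3; lra.
Qed.

Lemma mcvg_abel x S (r : nat -> K) (F : nat -> M) : mcvg (series x) S ->
  (forall n, 0 <= r n < 1) -> r @ \oo --> (1 : K) ->
  (forall n, mcvg (series (fun k => (r n ^+ k)%:C *: x k)) (F n)) -> mcvg F S.
Proof.
move=> xS r01 r1 rF; apply/mcvgP => e e0.
have e2 : 0 < e / 2 by rewrite divr_gt0.
have [C C0 bound] := abel_bound xS e2.
have d0 : 0 < e / 2 / (C + 1) by rewrite divr_gt0 // ltr_wpDl.
have [n0 _ n0P] : \forall n \near \oo, `|1 - r n| <= e / 2 / (C + 1).
  by move/cvgrPdist_le : r1; apply.
exists n0 => n /n0P /=; have /andP[r0 rlt] := r01 n.
have r1n : 0 <= 1 - r n by rewrite subr_ge0 ltW.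
rewrite ger0_norm // ler_pdivlMr ?ltr_wpDl // => h.
have := bound _ _ (r01 n) (rF n).
by move: h r1n; rewrite mulrDr mulr1; lra.
Qed.

End MatrixConvergence.

(** * Subexponential growth *)

Section Subexponential.
Variable K : realType.
Implicit Types (x y : nat -> K) (r : K).

Definition subexp x := forall r, 0 <= r < 1 -> exists C, forall m, x m * r ^+ m <= C.

Lemma subexp_le x y : (forall m, x m <= y m) -> subexp y -> subexp x.
Proof.
move=> xy sy r r01; have [C yC] := sy r r01; exists C => m.
by rewrite (le_trans _ (yC m)) // ler_wpM2r // exprn_ge0 //; case/andP: r01.
Qed.

Lemma subexp_cst (c : K) : subexp (fun=> c).
Proof.
move=> r /andP[r0 r1]; exists `|c| => m; rewrite (le_trans (ler_norm _)) //.
rewrite normrM -[leRHS]mulr1 ler_wpM2l // ger0_norm ?exprn_ge0 //.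
by rewrite exprn_ile1 // ltW.
Qed.

Lemma subexpM x y : (forall m, 0 <= x m) -> (forall m, 0 <= y m) ->
  subexp x -> subexp y -> subexp (fun m => x m * y m).
Proof.
move=> x0 y0 sx sy r /andP[r0 r1].
have s01 : 0 <= Num.sqrt r < 1.
  by rewrite sqrtr_ge0 -[ltRHS]sqrtr1 ltr_sqrt.
have [[C xC] [D yD]] := (sx _ s01, sy _ s01).
exists (C * D) => m; rewrite -(sqr_sqrtr r0) -exprM mul2n -addnn exprD mulrACA.
by apply: ler_pM => //; rewrite mulr_ge0 // exprn_ge0 // sqrtr_ge0.
Qed.

Lemma subexp_summable x r : (forall m, 0 <= x m) -> subexp x -> 0 <= r < 1 ->
  cvgn (series (fun m => x m * r ^+ m)).
Proof.
move=> x0 sx /andP[r0 r1].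
have /andP[s0 s1] : 0 <= Num.sqrt r < 1.
  by rewrite sqrtr_ge0 -[ltRHS]sqrtr1 ltr_sqrt.
have [|C xC] := sx (Num.sqrt r); first by rewrite s0.
have C0 : 0 <= C by apply: le_trans (xC 0); rewrite expr0 mulr1.
apply: (@series_le_cvg _ _ (geometric C (Num.sqrt r))) => [m|m|m|] /=.
- by rewrite mulr_ge0 // exprn_ge0.
- by rewrite mulr_ge0 // exprn_ge0.
- rewrite -[X in X ^+ m](sqr_sqrtr r0) -exprM mul2n -addnn exprD mulrA.
  by rewrite ler_wpM2r // exprn_ge0.
- by apply: is_cvg_geometric_series; rewrite ger0_norm.
Qed.

Lemma subexp_sum x : (forall m, 0 <= x m) -> subexp x ->
  subexp (fun m => \sum_(k < m.+1) x k).
Proof.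
move=> x0 sx r r01; have /andP[r0 r1] := r01.
have cv := subexp_summable x0 sx r01.
exists (limn (series (fun m => x m * r ^+ m))) => m.
apply: le_trans (nondecreasing_cvgn_le _ cv m.+1); last first.
  by apply: nondecreasing_series => k _ _; rewrite mulr_ge0 // exprn_ge0.
rewrite /series /= big_mkord mulr_suml ler_sum // => k _.
by rewrite ler_wpM2l // ler_wiXn2l ?(ltW r1) // -ltnS.
Qed.

Lemma le_sum_ord (f : nat -> K) m k : (forall j, 0 <= f j) -> (k < m)%N ->
  f k <= \sum_(j < m) f j.
Proof.
by move=> f0 km; rewrite (bigD1 (Ordinal km)) //= lerDl sumr_ge0.
Qed.

Lemma subexp_ratio x (p : nat) : (forall m, 0 <= x m) ->
  (forall m, (p < m)%N -> (m%:R - p%:R) * x m.+1 <= (m%:R + p%:R) * x m) ->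
  subexp x.
Proof.
move=> x0 xp r /andP[r0 r1].
pose b := Num.bound (p%:R * (1 + r) / (1 - r)).
have r1' : 0 < 1 - r by rewrite subr_gt0.
have bP : p%:R * (1 + r) / (1 - r) < b%:R.
  by apply: archi_boundP; apply: divr_ge0; [apply: mulr_ge0 => //; apply: addr_ge0|exact: ltW].
pose n0 := maxn b p.+1.
have s0 m : 0 <= x m * r ^+ m by rewrite mulr_ge0 // exprn_ge0.
have step m : (n0 <= m)%N -> x m.+1 * r ^+ m.+1 <= x m * r ^+ m.
  rewrite geq_max => /andP[bm pm]; rewrite exprS mulrA ler_wpM2r ?exprn_ge0 //.
  have pm' : 0 < m%:R - p%:R :> K by rewrite subr_gt0 ltr_nat.
  rewrite -(ler_pM2l pm') mulrA.
  have h1 := ler_wpM2r r0 (xp m pm).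
  apply: (le_trans h1); rewrite mulrAC ler_wpM2r //.
  have h2 : p%:R * (1 + r) < m%:R * (1 - r).
    by rewrite -ltr_pdivrMr // (lt_le_trans bP) // ler_nat.
  lra.
exists (\sum_(k < n0.+1) x k * r ^+ k) => m.
have [mn|/ltnW nm] := leqP m n0.
  by have := @le_sum_ord (fun k => x k * r ^+ k) n0.+1 m s0 mn.
rewrite -(subnK nm) addnC; elim: (m - n0)%N => [|d ih].
  by rewrite addn0; have := @le_sum_ord (fun k => x k * r ^+ k) n0.+1 n0 s0 (leqnn _).
by rewrite addnS (le_trans (step _ _)) // leq_addr.
Qed.

End Subexponential.

(** * Growth of Pochhammer symbols *)

Section Pochhammer.
Variables (K : realType) (N : nat).
Local Notation M := 'M[K[i]]_N.
Implicit Types (A B S : M) (u v c : nat -> M) (m j k : nat).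

Lemma natrC m : m%:R = (m%:R : K)%:C :> K[i].
Proof. by rewrite rmorph_nat. Qed.

Lemma l1Zn m A : l1 (m%:R *: A) = m%:R * l1 A.
Proof. by rewrite natrC l1Z ger0_norm. Qed.

Lemma poch0 A : poch A 0 = 1%:M.
Proof. by rewrite /poch big_ord0. Qed.

Lemma pochS A m : poch A m.+1 = poch A m *m (A + m%:R%:M).
Proof. by rewrite /poch big_ord_recr. Qed.

Lemma poch_add A k j : poch A (k + j) = poch A k *m poch (A + k%:R%:M) j.
Proof.
elim: j => [|j ih]; first by rewrite addn0 poch0 mulmx1.
by rewrite addnS !pochS ih mulmxA -addrA -raddfD -natrD.
Qed.

Lemma pochSl A m : poch A m.+1 = A *m poch (A + 1%:M) m.
Proof. by rewrite -[m.+1]/(1 + m)%N poch_add pochS poch0 mul1mx raddf0 addr0. Qed.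

Lemma comm_mx_shift A B k : comm_mx A B -> comm_mx A (B + k%:R%:M).
Proof. by move=> AB; apply: comm_mxD => //; exact: comm_mx_scalar. Qed.

Lemma comm_mx_poch A B m : comm_mx A B -> comm_mx A (poch B m).
Proof.
move=> AB; elim: m => [|m ih]; first by rewrite poch0; exact: comm_mx1.
by rewrite pochS; apply: comm_mxM => //; exact: comm_mx_shift.
Qed.

Lemma comm_mx_inv A B : comm_mx A B -> comm_mx A (invmx B).
Proof.
move=> AB; have [uB|nuB] := boolP (B \in unitmx); last by rewrite invmx_out.
by rewrite /comm_mx -[LHS](mulKmx uB) (mulmxA B) -AB -(mulmxA A) mulmxV ?mulmx1.
Qed.

Lemma poch_unit B m : (forall k, (B + k%:R%:M) \in unitmx) -> poch B m \in unitmx.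
Proof.
move=> uB; elim: m => [|m ih]; first by rewrite poch0 unitmx1.
by rewrite pochS unitmx_mul ih uB.
Qed.

Lemma l1_bound A : exists p, l1 A <= p.+1%:R.
Proof.
exists (Num.bound (l1 A)); rewrite ltW // (lt_le_trans (archi_boundP (l1_ge0 A))) //.
by rewrite ler_nat.
Qed.

Lemma poch_subexp A : subexp (fun m => l1 (poch A m) / m`!%:R).
Proof.
have [p Ap] := l1_bound A.
apply: (@subexp_ratio _ _ p.+1) => [m|m pm]; first by rewrite divr_ge0 ?l1_ge0.
have pm' : 0 < m%:R - p.+1%:R :> K by rewrite subr_gt0 ltr_nat.
rewrite pochS mulmxDr mul_mx_scalar factS natrM.
have h : l1 (poch A m *m A + m%:R *: poch A m) <= (p.+1%:R + m%:R) * l1 (poch A m).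
  rewrite (le_trans (l1D _ _)) // mulrDl l1Zn lerD // (le_trans (l1M _ _)) //.
  by rewrite mulrC ler_wpM2r // l1_ge0.
have hb := l1_ge0 (poch A m).
move: h; set a := l1 _; set b := l1 _ in hb *; set f := m`!%:R => h.
have f0 : 0 < f by rewrite ltr0n fact_gt0.
have m0 : 0 < m.+1%:R :> K by [].
rewrite invfM !mulrA ler_wpM2r ?invr_ge0 ?(ltW f0) //.
rewrite ler_pdivrMr // (le_trans (ler_wpM2l (ltW pm') h)) //.
rewrite mulrA [leRHS]mulrAC ler_wpM2r // -[m.+1]addn1 natrD.
have : 1 <= p.+1%:R :> K by rewrite ler1n.
have : 0 <= m%:R :> K by [].
set q := p.+1%:R; nra.
Qed.

Lemma poch_inv_subexp B : (forall k, (B + k%:R%:M) \in unitmx) ->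
  subexp (fun m => m`!%:R * l1 (invmx (poch B m))).
Proof.
move=> uB; have [p Bp] := l1_bound B.
apply: (@subexp_ratio _ _ p.+1) => [m|m pm]; first by rewrite mulr_ge0 ?l1_ge0.
set X := invmx (poch B m.+1); set Y := invmx (poch B m).
have XY : (B + m%:R%:M) *m X = Y.
  by rewrite -[LHS](mulKmx (poch_unit m uB)) (mulmxA (poch B m)) -pochS mulmxV ?mulmx1 ?poch_unit.
have h : m%:R * l1 X <= l1 Y + p.+1%:R * l1 X.
  rewrite -l1Zn; have -> : m%:R *: X = Y - B *m X.
    by rewrite -XY mulmxDl mul_scalar_mx addrC addKr.
  rewrite (le_trans (l1B _ _)) // lerD // (le_trans (l1M _ _)) //.
  by rewrite ler_wpM2r // l1_ge0.
have hX := l1_ge0 X; have hY := l1_ge0 Y.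
rewrite factS natrM; move: h; set a := l1 X in hX *; set b := l1 Y in hY *.
set q := p.+1%:R; have q1 : 1 <= q by rewrite ler1n.
rewrite -[m.+1]addn1 natrD; set mm := m%:R; set f := m`!%:R => h.
have f0 : 0 <= f by [].
have -> : (mm - q) * ((mm + 1) * f * a) = (mm + 1) * f * ((mm - q) * a) by ring.
have -> : (mm + q) * (f * b) = (mm + q) * f * b by ring.
have mm0 : 0 <= mm by [].
have h' : (mm - q) * a <= b by lra.
apply: (@le_trans _ _ ((mm + 1) * f * b)).
  by rewrite ler_wpM2l // mulr_ge0 // addr_ge0.
by rewrite ler_wpM2r // ler_wpM2r // lerD2l.
Qed.

(** * Binomial transform *)

Definition pev c (p : {poly K[i]}) : M := \sum_(k < size p) p`_k *: c k.

Lemma pevE c (p : {poly K[i]}) n : (size p <= n)%N ->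
  pev c p = \sum_(k < n) p`_k *: c k.
Proof.
move=> pn; rewrite /pev (big_ord_widen n (fun k => p`_k *: c k) pn) big_mkcond /=.
apply: eq_bigr => k _; case: ltnP => // hk.
by rewrite nth_default // scale0r.
Qed.

Lemma pev_is_linear c : linear (pev c).
Proof.
move=> a p q; pose s : {poly K[i]} := a *: p + q.
pose n := maxn (size s) (maxn (size p) (size q)).
have [h1 h2 h3] : [/\ (size s <= n)%N, (size p <= n)%N & (size q <= n)%N].
  by rewrite /n !leq_max !leqnn !orbT.
rewrite -/s (pevE c h1) (pevE c h2) (pevE c h3) scaler_sumr -big_split /=.
by apply: eq_bigr => k _; rewrite coefD coefZ scalerDl scalerA.
Qed.

HB.instance Definition _ c :=
  GRing.isLinear.Build K[i] {poly K[i]} M _ (pev c) (pev_is_linear c).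

Lemma pevXn c k : pev c 'X^k = c k.
Proof.
rewrite /pev size_polyXn (bigD1 ord_max) //= coefXn eqxx scale1r big1 ?addr0 //.
by move=> j /eqP jk; rewrite coefXn; case: eqP => [e|]; [case: jk; exact: val_inj|rewrite scale0r].
Qed.

Definition bintr c m : M := pev c ((1 - 'X) ^+ m).

Lemma pev_comp c p : pev (bintr c) p = pev c (p \Po (1 - 'X)).
Proof.
rewrite comp_polyE linear_sum; apply: eq_bigr => k _; by rewrite linearZ.
Qed.

Lemma bintrK c k : bintr (bintr c) k = c k.
Proof.
rewrite /bintr pev_comp -[RHS]pevXn; congr pev.
by rewrite rmorphXn /= rmorphB /= comp_polyC comp_polyX subKr.
Qed.

Lemma bintrE c m : bintr c m = \sum_(k < m.+1) ((-1) ^+ k * 'C(m, k)%:R) *: c k.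
Proof.
rewrite /bintr exprDn linear_sum; apply: eq_bigr => k _.
rewrite expr1n mul1r -scaler_nat linearZ /=.
by rewrite -scaleN1r exprZn linearZ /= pevXn scalerA mulrC.
Qed.

Lemma pascal_sum m (f : nat -> M) :
  \sum_(j < m.+1) 'C(m, j)%:R *: (f j.+1 + f j) =
  \sum_(j < m.+2) 'C(m.+1, j)%:R *: f j :> M.
Proof.
rewrite [RHS]big_ord_recl /= bin0.
under eq_bigr do rewrite scalerDr; rewrite big_split /= addrC.
under [X in _ = _ + X]eq_bigr => j _ do rewrite /bump /= add1n binS natrD scalerDl.
rewrite [X in _ = _ + X]big_split /= addrA; congr (_ + _).
rewrite big_ord_recl bin0; congr (_ + _).
by rewrite [RHS]big_ord_recr /= bin_small // scale0r addr0.
Qed.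

Definition bdiff c j k : M := pev c ((1 - 'X) ^+ j * 'X^k).

Lemma bdiff0 c k : bdiff c 0 k = c k.
Proof. by rewrite /bdiff expr0 mul1r pevXn. Qed.

Lemma bdiffS c j k : bdiff c j.+1 k = bdiff c j k - bdiff c j k.+1.
Proof.
rewrite /bdiff -linearB /= -mulrBr (exprS _ k) -[X in _ * (X - _)]mul1r -mulrBl.
by rewrite exprSr mulrA.
Qed.

Lemma bintr_bdiff c m : bintr c m = bdiff c m 0.
Proof. by rewrite /bdiff expr0 mulr1. Qed.

(* From 1 - xy = (1 - x) + x (1 - y) *)
Lemma bdiffM u v m n : bdiff (fun k => u k *m v k) m n =
  \sum_(j < m.+1) 'C(m, j)%:R *: (bdiff u j (n + m - j) *m bdiff v (m - j) n).
Proof.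
elim: m n => [|m ih] n.
  by rewrite big_ord1 bin0 scale1r !bdiff0 !subn0 addn0.
pose f j := bdiff u j (n + m.+1 - j) *m bdiff v (m.+1 - j) n.
rewrite bdiffS !ih -(pascal_sum m f) -sumrB; apply: eq_bigr => j _.
have jm : (j <= m)%N by rewrite -ltnS.
rewrite -scalerBr; congr (_ *: _); rewrite /f subSS addnS subSS.
rewrite addSn !subSn ?(leq_trans jm) ?leq_addl // !bdiffS mulmxBl mulmxBr.
by rewrite addrA subrK.
Qed.

Lemma bdiff_poch A B : comm_mx A B -> (forall k, (B + k%:R%:M) \in unitmx) ->
  forall j k, bdiff (fun m => poch A m *m invmx (poch B m)) j k =
    poch A k *m poch (B - A) j *m invmx (poch B (j + k)).
Proof.
move=> AB uB; elim=> [|j ih] k; first by rewrite bdiff0 poch0 mulmx1.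
rewrite bdiffS !ih addnS.
have -> : invmx (poch B (j + k)) = (B + (j + k)%:R%:M) *m invmx (poch B (j + k).+1).
  by rewrite -[RHS](mulKmx (poch_unit (j + k) uB)) (mulmxA (poch B _)) -pochS
     mulmxV ?mulmx1 ?poch_unit.
have cAS : (A + k%:R%:M) *m poch (B - A) j = poch (B - A) j *m (A + k%:R%:M).
  by apply/comm_mx_poch/comm_mx_sym/comm_mx_shift/comm_mx_sym/comm_mxB.
rewrite (pochS A k) -(mulmxA (poch A k) (A + _)) cAS !mulmxA -mulmxBl -mulmxBr.
rewrite (pochS (B - A)) !mulmxA; congr (_ *m _ *m _).
by rewrite natrD raddfD /= addrA [A + _]addrC addrKA addrAC.
Qed.

Lemma natr_binE m j : (j <= m)%N ->
  'C(m, j)%:R * (m - j)`!%:R * j`!%:R = m`!%:R :> K.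
Proof. by move=> jm; rewrite -!natrM -mulnA (mulnC (_`!)) bin_fact. Qed.

(* [bdiffM] writes the transform as a sum without cancellation *)
Lemma bintr_poch_subexp A B A' B' : comm_mx A B -> comm_mx A' B' ->
  (forall k, (B + k%:R%:M) \in unitmx) -> (forall k, (B' + k%:R%:M) \in unitmx) ->
  subexp (fun m => l1 (bintr (fun k =>
    (poch A k *m invmx (poch B k)) *m (poch A' k *m invmx (poch B' k))) m)).
Proof.
move=> AB AB' uB uB'.
pose fa m := l1 (poch A m) / m`!%:R.
pose fs m := l1 (poch (B - A) m) / m`!%:R.
pose ft m := l1 (poch (B' - A') m) / m`!%:R.
pose fb m := m`!%:R * l1 (invmx (poch B m)).
pose fc m := m`!%:R * l1 (invmx (poch B' m)).
have f0 m : 0 < m`!%:R :> K by rewrite ltr0n fact_gt0.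
have a0 m : 0 <= fa m by rewrite divr_ge0 ?l1_ge0.
have s0 m : 0 <= fs m by rewrite divr_ge0 ?l1_ge0.
have t0 m : 0 <= ft m by rewrite divr_ge0 ?l1_ge0.
have b0 m : 0 <= fb m by rewrite mulr_ge0 ?l1_ge0.
have c0 m : 0 <= fc m by rewrite mulr_ge0 ?l1_ge0.
pose S (f : nat -> K) m := \sum_(k < m.+1) f k.
have S0 (f : nat -> K) : (forall m, 0 <= f m) -> forall m, 0 <= S f m.
  by move=> f_ge0 m; apply: sumr_ge0.
have Sge (f : nat -> K) m j : (forall m, 0 <= f m) -> (j <= m)%N -> f j <= S f m.
  by move=> f_ge0 jm; exact: (@le_sum_ord _ f).
apply: (@subexp_le _ _ (fun m => S (fun=> 1) m *
    (S fa m * S fs m * (fb m * (S ft m * S fc m))))).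
  move=> m; rewrite bintr_bdiff bdiffM (le_trans (l1_sum _ _ _)) //.
  rewrite {1}/S mulr_suml ler_sum // => -[j jm] _ /=; rewrite mul1r l1Zn.
  rewrite add0n !bdiff_poch // poch0 mul1mx addn0 subnKC //.
  have mj := leq_subr j m.
  apply: (@le_trans _ _ (fa (m - j)%N * fs j * (fb m * (ft (m - j)%N * fc (m - j)%N)))).
    rewrite (_ : _ * (fb m * _) = 'C(m, j)%:R *
      (l1 (poch A (m - j)) * l1 (poch (B - A) j) * l1 (invmx (poch B m)) *
       (l1 (poch (B' - A') (m - j)) * l1 (invmx (poch B' (m - j)))))).
      rewrite ler_wpM2l // (le_trans (l1M _ _)) // ler_pM ?l1_ge0 ?l1M //.
      by rewrite (le_trans (l1M _ _)) // ler_wpM2r ?l1_ge0 // l1M.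
    rewrite /fa /fs /fb /ft /fc -(natr_binE (jm : (j <= m)%N)).
    field.
    by rewrite !gt_eqF.
  have h1 := ler_pM (a0 _) (s0 _) (Sge _ _ _ a0 mj) (Sge _ m j s0 jm).
  have h2 := ler_pM (t0 _) (c0 _) (Sge _ _ _ t0 mj) (Sge _ _ _ c0 mj).
  apply: ler_pM; [exact: mulr_ge0|do 2![apply: mulr_ge0 => //]|exact: h1|].
  exact: ler_wpM2l.
have c1 (m : nat) : 0 <= (1 : K) by [].
have X0 (f g : nat -> K) : (forall m, 0 <= f m) -> (forall m, 0 <= g m) ->
    forall m, 0 <= f m * g m.
  by move=> f_ge0 g_ge0 m; exact: mulr_ge0.
have sa := subexp_sum a0 (poch_subexp A).
have ss := subexp_sum s0 (poch_subexp (B - A)).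
have st := subexp_sum t0 (poch_subexp (B' - A')).
have sb : subexp fb := poch_inv_subexp uB.
have sc := subexp_sum c0 (poch_inv_subexp uB').
have s1 := subexp_sum c1 (@subexp_cst _ 1).
have [Sa Ss St Sc] := And4 (S0 _ a0) (S0 _ s0) (S0 _ t0) (S0 _ c0).
have st_c := subexpM St Sc st sc.
have sab_c := subexpM b0 (X0 _ _ St Sc) sb st_c.
have all_s := subexpM (X0 _ _ Sa Ss) (X0 _ _ b0 (X0 _ _ St Sc)) (subexpM Sa Ss sa ss) sab_c.
exact: subexpM (S0 _ c1) (X0 _ _ (X0 _ _ Sa Ss) (X0 _ _ b0 (X0 _ _ St Sc))) s1 all_s.
Qed.

End Pochhammer.

(** * The binomial series of a matrix *)

Section BinomialSeries.
Variables (K : realType) (N : nat).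
Local Notation M := 'M[K[i]]_N.
Implicit Types (A P : M) (u v c : nat -> M) (m j k : nat) (r s : K).

Definition pochf A m : M := m`!%:R^-1 *: poch A m.

Definition bser A r : M := limn (series (fun j => (r ^+ j)%:C *: pochf A j)).

Lemma pochf0 A : pochf A 0 = 1%:M.
Proof. by rewrite /pochf poch0 fact0 invr1 scale1r. Qed.

Lemma pochf1 A : pochf A 1 = A.
Proof. by rewrite /pochf pochS poch0 mul1mx raddf0 addr0 invr1 scale1r. Qed.

Lemma l1_pochf A m : l1 (pochf A m) = l1 (poch A m) / m`!%:R.
Proof.
by rewrite /pochf natrC -fmorphV l1Z ger0_norm ?invr_ge0 // mulrC.
Qed.

Lemma comm_mx_pochf A P m : comm_mx A P -> comm_mx A (pochf P m).
Proof.
by move=> AP; rewrite /comm_mx -scalemxAr -scalemxAl (comm_mx_poch m AP).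
Qed.

Lemma pochf_add A k j :
  'C(k + j, k)%:R *: pochf A (k + j) = pochf (A + k%:R%:M) j *m pochf A k.
Proof.
have cA : comm_mx (pochf (A + k%:R%:M) j) (pochf A k).
  apply/comm_mx_pochf/comm_mx_sym/comm_mx_pochf.
  exact/comm_mx_shift/comm_mx_refl.
rewrite cA /pochf -scalemxAl -scalemxAr -poch_add !scalerA; congr (_ *: _).
rewrite -(bin_fact (leq_addr j k)) addKn !natrM.
have f0 m : m`!%:R != 0 :> K[i] by rewrite pnatr_eq0 -lt0n fact_gt0.
have b0 : 'C(k + j, k)%:R != 0 :> K[i] by rewrite pnatr_eq0 -lt0n bin_gt0 leq_addr.
by field; rewrite !f0 b0.
Qed.

Lemma pochf_pascal A j : pochf (A + 1%:M) j.+1 = pochf A j.+1 + pochf (A + 1%:M) j.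
Proof.
have -> : pochf (A + 1%:M) j = j.+1`!%:R^-1 *: (j.+1%:R *: poch (A + 1%:M) j).
  rewrite scalerA; congr (_ *: _); rewrite factS natrM invfM mulrAC.
  by rewrite mulVf ?mul1r // (pnatr_eq0 K[i] j.+1).
rewrite /pochf -scalerDr; congr (_ *: _); rewrite (pochSl A) pochS.
rewrite (comm_mx_poch (A := A)); last first.
  by apply: comm_mxD; [exact: comm_mx_refl|exact: comm_mx1].
rewrite -mul_mx_scalar -mulmxDr; congr (_ *m _).
by rewrite -addrA -raddfD /= -[in RHS]add1n natrD.
Qed.

Lemma bserP A r : 0 <= r < 1 ->
  mcvg (series (fun j => (r ^+ j)%:C *: pochf A j)) (bser A r).
Proof.
move=> r01; have /andP[r0 r1] := r01.
apply: (@is_mcvg_series_le _ _ _ (fun j => l1 (poch A j) / j`!%:R * r ^+ j)).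
  by move=> k; rewrite l1Z l1_pochf ger0_norm ?exprn_ge0 // mulrC.
apply: subexp_summable r01; last exact: poch_subexp.
by move=> m; rewrite divr_ge0 ?l1_ge0.
Qed.

Lemma bser_add1 A r : 0 <= r < 1 -> (1 - r)%:C *: bser (A + 1%:M) r = bser A r.
Proof.
move=> r01; set f := fun B j => (r ^+ j)%:C *: pochf B j.
have rec n : series (f (A + 1%:M)) n.+1 =
    series (f A) n.+1 + r%:C *: series (f (A + 1%:M)) n.
  rewrite /series /= !big_nat_recl // /f !pochf0 -addrA; congr (_ + _).
  rewrite scaler_sumr -big_split /=; apply: eq_bigr => j _.
  by rewrite pochf_pascal scalerDr [r%:C *: _]scalerA -rmorphM /= -exprS.
have lim1 := mcvg_comp (h := S) (fun m => ex_intro _ m (fun n => @leqW m n)).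
have l1' := lim1 _ _ _ _ (bserP (A + 1%:M) r01).
have l2' := mcvgD (lim1 _ _ _ _ (bserP A r01))
  (mcvgZl r%:C (bserP (A + 1%:M) r01)).
have := mcvg_unique l1' (mcvg_eq (fun n => esym (rec n)) l2').
by rewrite rmorphB /= scalerBl scale1r => {1}->; rewrite addrK.
Qed.

Lemma bser_addn A k r : 0 <= r < 1 ->
  bser (A + k%:R%:M) r = ((1 - r) ^- k)%:C *: bser A r.
Proof.
move=> r01; have r1 : 1 - r != 0 by rewrite subr_eq0 gt_eqF //; case/andP: r01.
elim: k => [|k ih]; first by rewrite raddf0 addr0 expr0 invr1 scale1r.
have e := bser_add1 (A + k%:R%:M) r01; rewrite ih in e.
have iV : ((1 - r)^-1)%:C * (1 - r)%:C = 1 :> K[i] by rewrite -rmorphM mulVf.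
rewrite -[k.+1]addn1 natrD raddfD /= addrA.
move: e; move: (bser (_ + 1%:M) r) (bser A r) => X Y e.
rewrite -(scale1r X) -{}[1]iV -(scalerA _ _ X) e scalerA -rmorphM /=.
by rewrite addn1 exprSr invfM mulrC.
Qed.

Lemma binS_sum_le r n J : 0 <= r < 1 ->
  \sum_(0 <= j < J) 'C(n + j, j)%:R * r ^+ j <= (1 - r) ^- n.+1.
Proof.
move=> /andP[r0 r1]; have r1' : 0 < 1 - r by rewrite subr_gt0.
have T0 n' j : 0 <= 'C(n' + j, j)%:R * r ^+ j by rewrite mulr_ge0 // exprn_ge0.
elim: n J => [|n ih] J.
  rewrite expr1 -[leRHS]mul1r ler_pdivlMr //.
  under eq_bigr do rewrite add0n binn mul1r.
  have -> : (\sum_(0 <= j < J) r ^+ j) * (1 - r) = 1 - r ^+ J.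
    elim: J => [|J ihJ]; first by rewrite big_geq // mul0r expr0 subrr.
    by rewrite big_nat_recr //= mulrDl ihJ exprS; ring.
  by rewrite gerBl exprn_ge0.
rewrite exprS invfM ler_pdivlMl //; apply: le_trans (ih J).
case: J => [|J]; first by rewrite !big_geq // mulr0.
set S := \sum_(0 <= j < J.+1) _; set S' := \sum_(0 <= j < J.+1) _.
suff h : S <= S' + r * S by lra.
apply: (@le_trans _ _ (S' + r * \sum_(0 <= j < J) 'C(n.+1 + j, j)%:R * r ^+ j)).
  rewrite /S /S' !big_nat_recl // !addn0 !bin0 -addrA lerD2l.
  rewrite mulr_sumr -big_split /=; apply: ler_sum => j _.
  have -> : 'C(n.+1 + j.+1, j.+1) = ('C(n + j.+1, j.+1) + 'C(n.+1 + j, j))%N.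
    by rewrite addSn binS addSnnS.
  by rewrite natrD mulrDl lerD2l exprS mulrCA.
rewrite lerD2l ler_wpM2l // /S [leRHS]big_nat_recr //= lerDl //.
Qed.

Lemma poch_addn_le A p k j : l1 A <= p.+1%:R ->
  l1 (poch (A + k%:R%:M) j) <= l1 (1%:M : M) * (j`!%:R * 'C(p + k + j, j)%:R).
Proof.
move=> Ap; elim: j => [|j ih]; first by rewrite poch0 bin0 mulr1 mulr1.
rewrite pochS -addrA -raddfD -natrD /= mulmxDr mul_mx_scalar.
have -> : j.+1`!%:R * 'C(p + k + j.+1, j.+1)%:R =
    (j`!%:R * 'C(p + k + j, j)%:R) * (p.+1%:R + (k + j)%:R) :> K.
  rewrite -natrD -!natrM; congr (_%:R).
  rewrite factS mulnAC addnS -mul_bin_diag /= mulnC [(_ * 'C(_, _))%N]mulnC mulnA.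
  by congr (_ * _)%N; rewrite addSn addnA.
rewrite mulrA (le_trans _ (ler_wpM2r _ ih)) ?addr_ge0 //.
rewrite (le_trans (l1D _ _)) // mulrDr lerD //.
  by rewrite (le_trans (l1M _ _)) // ler_wpM2l // l1_ge0.
by rewrite l1Zn mulrC.
Qed.

Lemma sum_triangle (f : nat -> nat -> M) n :
  \sum_(0 <= m < n) \sum_(k < m.+1) f k (m - k)%N =
  \sum_(0 <= k < n) \sum_(0 <= j < n - k) f k j.
Proof.
elim: n => [|n ih]; first by rewrite !big_geq.
rewrite big_nat_recr //= ih [RHS]big_nat_recr //= subSnn big_nat1.
rewrite big_ord_recr /= subnn addrA; congr (_ + _).
rewrite -(big_mkord predT (fun k => f k (n - k)%N)) -big_split /=.
rewrite big_nat [RHS]big_nat; apply: eq_bigr => k /andP[_ kn].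
by rewrite subSn ?(ltnW kn) // big_nat_recr.
Qed.

Definition euler_dom c P r k : M := ((- (r / (1 - r))) ^+ k)%:C *: (pochf P k *m c k).

Definition euler_im c P r m : M := (r ^+ m)%:C *: (pochf P m *m bintr c m).

(* Expanding the transform and summing first over [m - k], the inner sums are
   binomial series of [P + k]. *)
Lemma euler_transform_abs P c r : 0 <= r < 1 ->
  cvgn (series (fun k => l1 (euler_dom c P r k))) ->
  mcvg (series (euler_im c P r)) (bser P r *m limn (series (euler_dom c P r))).
Proof.
move=> r01 cv; have /andP[r0 r1] := r01.
have r1' : 0 < 1 - r by rewrite subr_gt0.
pose z k j : M := (r ^+ j)%:C *: (pochf (P + k%:R%:M) j *m
  (((- r) ^+ k)%:C *: (pochf P k *m c k))).
pose y k n := \sum_(0 <= j < n - k) z k j.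
have zE m k : (k <= m)%N -> (r ^+ m)%:C *: (pochf P m *m
    (((-1) ^+ k * 'C(m, k)%:R) *: c k)) = z k (m - k)%N.
  move=> km; rewrite /z; have := pochf_add P k (m - k); rewrite (subnKC km).
  move: (pochf P m) (pochf _ (m - k)) (pochf P k) => X Y Z e.
  rewrite -!scalemxAr !scalerA mulmxA -e -scalemxAl scalerA; congr (_ *: _).
  have -> : (-1) ^+ k = ((-1) ^+ k : K)%:C :> K[i].
    by rewrite rmorphXn rmorphN rmorph1.
  have -> : r ^+ m = r ^+ (m - k) * r ^+ k by rewrite -exprD subnK.
  by rewrite (exprNn r) !rmorphM /= -!mulrA (mulrCA (r ^+ k)%:C).
have ysum n : series (euler_im c P r) n = \sum_(0 <= k < n) y k n.
  rewrite /y -sum_triangle /series /=; apply: eq_bigr => m _.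
  rewrite /euler_im bintrE mulmx_sumr scaler_sumr; apply: eq_bigr => k _.
  by rewrite zE // -ltnS.
have [p Pp] := l1_bound P; set I1 := l1 (1%:M : M).
have I0 : 0 <= I1 by exact: l1_ge0.
pose d k := l1 (euler_dom c P r k).
have dE k : d k = (r / (1 - r)) ^+ k * l1 (pochf P k *m c k).
  by rewrite /d l1Z exprNn normrMsign ger0_norm // exprn_ge0 // divr_ge0 // ltW.
pose C := I1 * (1 - r) ^- p.+1.
have yb k n : l1 (y k n) <= C * d k.
  have -> : C * d k = I1 * (r ^+ k * l1 (pochf P k *m c k)) * (1 - r) ^- (p + k).+1.
    rewrite dE /C -addSn exprD invfM expr_div_n.
    by rewrite -!mulrA; congr (_ * _); ring.
  rewrite (le_trans (l1_sum _ _ _)) //.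
  apply: (@le_trans _ _ (I1 * (r ^+ k * l1 (pochf P k *m c k)) *
      \sum_(0 <= j < n - k) 'C(p + k + j, j)%:R * r ^+ j)); last first.
    rewrite ler_wpM2l ?binS_sum_le // ?r0 // mulr_ge0 // mulr_ge0 ?l1_ge0 //.
    exact: exprn_ge0.
  rewrite mulr_sumr; apply: ler_sum => j _.
  rewrite /z l1Z ger0_norm ?exprn_ge0 // mulrA [leRHS]mulrC ler_wpM2l ?exprn_ge0 //.
  rewrite (le_trans (l1M _ _)) // l1Z exprNn normrMsign ger0_norm ?exprn_ge0 //.
  rewrite mulrAC ler_wpM2r ?mulr_ge0 ?exprn_ge0 ?l1_ge0 //.
  rewrite l1_pochf ler_pdivrMr ?ltr0n ?fact_gt0 //.
  by rewrite -mulrA [X in _ * X]mulrC poch_addn_le.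
have cvC : cvgn (series (fun k => C * d k)).
  suff -> : series (fun k => C * d k) = fun n => C * series d n.
    by apply: is_cvgM => //; exact: is_cvg_cst.
  by apply/funext => n; rewrite /series /= mulr_sumr.
have yY k : mcvg (y k) (bser P r *m euler_dom c P r k).
  have h m : exists n0, forall n, (n0 <= n)%N -> (m <= n - k)%N.
    by exists (m + k)%N => n; lia.
  have -> : bser P r *m euler_dom c P r k =
      bser (P + k%:R%:M) r *m (((- r) ^+ k)%:C *: (pochf P k *m c k)).
    rewrite bser_addn // /euler_dom; move: (bser P r) (pochf P k *m c k) => B W.
    rewrite -scalemxAl -!scalemxAr scalerA -rmorphM /=.
    by rewrite [_ * (- r) ^+ k]mulrC -expr_div_n mulNr.
  apply: mcvg_eq (mcvgMr _ (mcvg_comp h (bserP (P + k%:R%:M) r01))) => n.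
  rewrite /= /y /z; move: (((- r) ^+ k)%:C *: _) => W.
  by rewrite /series /= mulmx_suml; apply: eq_bigr => j _; rewrite scalemxAl.
have := mcvg_dominated_sum (h := id) leqnn yb yY cvC.
suff -> : limn (series (fun k => bser P r *m euler_dom c P r k)) =
    bser P r *m limn (series (euler_dom c P r)).
  by apply: mcvg_eq => n; rewrite ysum.
apply: mcvg_lim; have := is_mcvg_series_le (fun k => lexx (d k)) cv.
by move=> /(mcvgMl (bser P r)); apply: mcvg_eq => n; rewrite mulmx_sumr.
Qed.

End BinomialSeries.

Section Euler.
Variables (K : realType) (N : nat).
Local Notation M := 'M[K[i]]_N.
Implicit Types (A P : M) (u v c : nat -> M) (m j k : nat) (r s : K).

Lemma euler_transform P c r X Y : 0 <= r < 1 ->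
  mcvg (series (euler_dom c P r)) X -> mcvg (series (euler_im c P r)) Y ->
  Y = bser P r *m X.
Proof.
move=> r01 dX iY; have /andP[r0 r1] := r01.
pose t n : K := 1 - harmonic n.+1.
have t01 n : 0 <= t n < 1.
  have h0 : 0 < n.+2%:R^-1 :> K by rewrite invr_gt0.
  have h1 : n.+2%:R^-1 <= 1 :> K by rewrite invf_le1 // ler1n.
  rewrite /t /harmonic /=; apply/andP; split; first by rewrite subr_ge0.
  by rewrite ltrBlDr ltrDl.
have t1 : (t @ \oo --> (1 : K))%classic.
  rewrite -(subr0 (1 : K)); apply: cvgB; first exact: cvg_cst.
  by move: (@cvg_harmonic K); rewrite -cvg_shiftS.
pose s n := t n * r; pose q n := t n * (1 - r) / (1 - s n).
have s01 n : 0 <= s n < 1.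
  have /andP[t0 t1'] := t01 n; rewrite mulr_ge0 //= /s.
  by rewrite (le_lt_trans _ r1) // ler_piMl // ltW.
have q01 n : 0 <= q n < 1.
  have /andP[t0 t1'] := t01 n; have /andP[s0 s1] := s01 n.
  have [r1' s1'] : 0 < 1 - r /\ 0 < 1 - s n by rewrite !subr_gt0.
  rewrite /q divr_ge0 ?mulr_ge0 ?(ltW r1') ?(ltW s1') //=.
  by rewrite ltr_pdivrMr ?subr_gt0 // mul1r mulrBr mulr1 /s ltrD2r.
have q1 : (q @ \oo --> (1 : K))%classic.
  have r1' : 1 - r != 0 by rewrite subr_eq0 gt_eqF.
  have -> : (1 : K) = 1 * (1 - r) / (1 - 1 * r) by rewrite !mul1r divff.
  apply: cvgM; first by apply: cvgM => //; exact: cvg_cst.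
  apply: cvgV; first by rewrite mul1r.
  apply: cvgB; first exact: cvg_cst.
  by apply: cvgM => //; exact: cvg_cst.
have dq n k : euler_dom c P (s n) k = (q n ^+ k)%:C *: euler_dom c P r k.
  rewrite /euler_dom; move: (pochf P k *m c k) => W.
  rewrite scalerA -rmorphM -exprMn /=; congr (_ %:C *: _); congr (_ ^+ _).
  rewrite /q /s.
  have n1 : 1 - r != 0 by rewrite subr_eq0 gt_eqF.
  have n2 : 1 - t n * r != 0.
    by rewrite subr_eq0 gt_eqF //; have /andP[] := s01 n.
  by field; rewrite n1 n2.
have [C C0 dC] := mcvg_series_bounded dX.
have cvd n : cvgn (series (fun k => l1 (euler_dom c P (s n) k))).
  apply: (@series_le_cvg _ _ (geometric C (q n))) => [k|k|k|] /=.
  - exact: l1_ge0.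
  - by have /andP[q0 _] := q01 n; rewrite mulr_ge0 // exprn_ge0.
  - have /andP[q0 _] := q01 n; rewrite dq l1Z ger0_norm ?exprn_ge0 // mulrC.
    by rewrite ler_wpM2r // exprn_ge0.
  - by have /andP[q0 q1'] := q01 n; apply: is_cvg_geometric_series; rewrite ger0_norm.
have XX : mcvg (fun n => limn (series (euler_dom c P (s n)))) X.
  apply: (mcvg_abel dX q01 q1) => n.
  apply: mcvg_eq (is_mcvg_series_le (fun k => lexx _) (cvd n)) => m.
  by apply: eq_bigr => k _; exact: dq.
have BB : mcvg (fun n => bser P (s n)) (bser P r).
  apply: (mcvg_abel (bserP P r01) t01 t1) => n.
  apply: mcvg_eq (bserP P (s01 n)) => m; apply: eq_bigr => k _.
  by rewrite scalerA -rmorphM -exprMn.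
apply: mcvg_unique (mcvgM BB XX).
apply: (mcvg_abel iY t01 t1) => n.
apply: mcvg_eq (euler_transform_abs (s01 n) (cvd n)) => m.
by apply: eq_bigr => k _; rewrite /euler_im scalerA -rmorphM -exprMn.
Qed.

End Euler.

(** * The matrix exponential *)

Section MatrixExponential.
Variables (K : realType) (N : nat).
Local Notation M := 'M[K[i]]_N.
Implicit Types (A B P X : M) (u v c : nat -> M) (m j k n : nat) (r s : K).

Lemma l1_exp A k C : l1 A <= C -> l1 (A ^+ k) <= l1 (1%:M : M) * C ^+ k.
Proof.
move=> AC; elim: k => [|k ih]; first by rewrite !expr0 mulr1.
rewrite !exprSr mulrA (le_trans (l1M _ _)) // ler_pM ?l1_ge0 //.
Qed.

Lemma mexpP A : mcvg (series (fun k => k`!%:R^-1 *: A ^+ k)) (mexp A).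
Proof.
apply: (@is_mcvg_series_le _ _ _ (fun k => l1 (1%:M : M) * exp_coeff (l1 A) k)).
  move=> k; rewrite natrC -fmorphV l1Z ger0_norm ?invr_ge0 //.
  rewrite /exp_coeff /= mulrA [leRHS]mulrC ler_wpM2l ?invr_ge0 //.
  exact: l1_exp.
suff -> : series (fun k => l1 (1%:M : M) * exp_coeff (l1 A) k) =
    fun n => l1 (1%:M : M) * series (exp_coeff (l1 A)) n.
  by apply: is_cvgM; [exact: is_cvg_cst|exact: is_cvg_series_exp_coeff].
by apply/funext => n; rewrite /series /= mulr_sumr.
Qed.

Lemma bin_coef_cvg k :
  ('C(n.+1, k)%:R / n.+1%:R ^+ k @[n --> \oo] --> (k`!%:R^-1 : K))%classic.
Proof.
elim: k => [|k ih].
  have -> : (fun n => 'C(n.+1, 0)%:R / n.+1%:R ^+ 0 : K) = fun=> 1.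
    by apply/funext => n; rewrite bin0 expr0 divr1.
  by rewrite fact0 invr1; exact: cvg_cst.
have -> : (fun n => 'C(n.+1, k.+1)%:R / n.+1%:R ^+ k.+1 : K) =
    (fun n => 'C(n.+1, k)%:R / n.+1%:R ^+ k * (1 - k%:R * harmonic n) * k.+1%:R^-1).
  apply/funext => n; have n0 : n.+1%:R != 0 :> K by rewrite pnatr_eq0.
  have k0 : k.+1%:R != 0 :> K by rewrite pnatr_eq0.
  have -> : 'C(n.+1, k.+1)%:R = 'C(n.+1, k)%:R * (n.+1%:R - k%:R) / k.+1%:R :> K.
    apply: (mulIf k0); rewrite divfK // -natrM mulnC mul_bin_left.
    have [kn|nk] := leqP k n.+1; first by rewrite natrM natrB // mulrC.
    by rewrite bin_small // muln0 mul0r.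
  rewrite /harmonic /= exprSr; move: n0 k0 => /=.
  move: n.+1%:R k.+1%:R => a b a0 b0; field.
  by rewrite expf_neq0 ?a0 ?b0.
have h0 : (k%:R * harmonic n @[n --> \oo] --> (0 : K))%classic.
  by rewrite -(mulr0 (k%:R : K)); apply: cvgM; [exact: cvg_cst|exact: cvg_harmonic].
have -> : (k.+1`!%:R^-1 : K) = k`!%:R^-1 * (1 - 0) * k.+1%:R^-1.
  by rewrite factS natrM invfM subr0 mulr1 mulrC.
apply: cvgM; last exact: cvg_cst.
by apply: cvgM => //; apply: cvgB => //; exact: cvg_cst.
Qed.

Lemma mcvgX u A k : mcvg u A -> mcvg (fun n => u n ^+ k) (A ^+ k).
Proof.
move=> uA; elim: k => [|k ih]; first exact: mcvg_cst.
rewrite exprSr; apply: mcvg_eq (mcvgM ih uA) => n.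
by rewrite exprSr.
Qed.

Lemma mcvg_exp (X : nat -> M) A : mcvg X A ->
  mcvg (fun n => (1 + (n.+1%:R^-1)%:C *: X n) ^+ n.+1) (mexp A).
Proof.
move=> XA; have [B B0 XB] := mcvg_bounded XA.
pose y k n : M := ('C(n.+1, k)%:R / n.+1%:R ^+ k)%:C *: X n ^+ k.
have yE n : (1 + (n.+1%:R^-1)%:C *: X n) ^+ n.+1 = \sum_(0 <= k < n.+2) y k n.
  have com : GRing.comm (1 : M) ((n.+1%:R^-1)%:C *: X n) by exact/commr_sym/commr1.
  rewrite (exprDn_comm _ com) big_mkord; apply: eq_bigr => k _.
  rewrite expr1n mul1r /y.
  have -> : ((n.+1%:R^-1)%:C *: X n) ^+ k = ((n.+1%:R^-1) ^+ k)%:C *: X n ^+ k.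
    elim: (k : nat) => [|k' ih]; first by rewrite !expr0 scale1r.
    rewrite !exprSr ih -[LHS]/(_ *m _) -scalemxAl -scalemxAr scalerA -rmorphM //.
  rewrite -scaler_nat scalerA natrC -rmorphM; congr (_%:C *: _).
  by rewrite exprVn.
have yb k n : l1 (y k n) <= l1 (1%:M : M) * exp_coeff B k.
  rewrite /y l1Z ger0_norm ?divr_ge0 ?exprn_ge0 // /exp_coeff /= mulrC mulrA.
  apply: ler_pM; rewrite ?l1_ge0 ?divr_ge0 ?exprn_ge0 ?l1_exp //.
  have n0 : 0 < n.+1%:R ^+ k :> K by rewrite exprn_gt0.
  rewrite ler_pdivrMr // ler_pdivlMl ?ltr0n ?fact_gt0 //.
  rewrite -natrX -natrM ler_nat mulnC bin_ffact.
  elim: (k) => [|k' ih]; first by rewrite ffactn0.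
  by rewrite ffactnSr expnSr leq_mul // leq_subr.
have yY k : mcvg (y k) (k`!%:R^-1 *: A ^+ k).
  rewrite natrC -fmorphV; 

  exact: mcvgZ (@bin_coef_cvg k) (mcvgX k XA).
have cvb : cvgn (series (fun k => l1 (1%:M : M) * exp_coeff B k)).
  suff -> : series (fun k => l1 (1%:M : M) * exp_coeff B k) =
      fun n => l1 (1%:M : M) * series (exp_coeff B) n.
    by apply: is_cvgM; [exact: is_cvg_cst|exact: is_cvg_series_exp_coeff].
  by apply/funext => n; rewrite /series /= mulr_sumr.
have hn n : (n <= n.+2)%N by lia.
by apply: mcvg_eq (mcvg_dominated_sum hn yb yY cvb) => n; rewrite yE.
Qed.

Lemma mexp0 : mexp (0 : M) = 1%:M.
Proof.
apply: mcvg_unique (mcvg_exp (mcvg_cst 0)) _.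
by apply: mcvg_eq (mcvg_cst 1) => n; rewrite scaler0 addr0 expr1n.
Qed.

Lemma mcvg_invn A : mcvg (fun n => (n.+1%:R^-1)%:C *: A) 0.
Proof.
rewrite -(scale0r A); apply: mcvgZ (mcvg_cst A); exact: cvg_harmonic.
Qed.

(* Both sides are limits of (1 + A/n)^n (1 + B/n)^n. *)
Lemma mexpD A B : comm_mx A B -> mexp (A + B) = mexp A *m mexp B.
Proof.
move=> AB; pose X n := A + B + (n.+1%:R^-1)%:C *: (A *m B).
have XAB : mcvg X (A + B).
  by rewrite -[A + B]addr0; apply: mcvgD; [exact: mcvg_cst|exact: mcvg_invn].
apply: mcvg_unique (mcvg_exp XAB) _.
apply: mcvg_eq (mcvgM (mcvg_exp (mcvg_cst A)) (mcvg_exp (mcvg_cst B))) => n.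
set q := (n.+1%:R^-1)%:C.
have com : GRing.comm (1 + q *: A : M) (1 + q *: B).
  rewrite -comm_mxE; apply: comm_mxD; first exact: comm_mx1.
  apply/comm_mx_sym/comm_mxD; first exact: comm_mx1.
  by rewrite /comm_mx -!scalemxAl -!scalemxAr AB.
rewrite -[LHS]/(_ * _) -(exprMn_comm _ com); congr (_ ^+ _).
rewrite mulrDl mul1r mulrDr mulr1 -addrA; congr (_ + _).
by rewrite /X !scalerDr addrA [q *: B + _]addrC -[_ * _]/(_ *m _) -scalemxAl -scalemxAr.
Qed.

Lemma mexpN A : mexp A *m mexp (- A) = 1%:M.
Proof.
rewrite -mexpD ?subrr ?mexp0 //; apply: comm_mxN; exact: comm_mx_refl.
Qed.

End MatrixExponential.

Section BinomialSeriesExp.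
Variables (K : realType) (N : nat).
Local Notation M := 'M[K[i]]_N.
Implicit Types (A P X : M) (u v c : nat -> M) (m j k n : nat) (r s : K).

Lemma pev_geometric (z : K[i]) p : pev (fun k => (z ^+ k)%:M : M) p = p.[z]%:M.
Proof.
rewrite /pev horner_coef raddf_sum; apply: eq_bigr => k _.
by rewrite scale_scalar_mx.
Qed.

Lemma bser0 P : bser P 0 = 1%:M.
Proof.
have r01 : 0 <= (0 : K) < 1 by rewrite lexx ltr01.
apply: mcvg_near (bserP P r01); exists 1%N => // -[//|n] _.
rewrite /series /= big_nat_recl // expr0 scale1r pochf0 big1 ?addr0 // => j _.
by rewrite expr0n /= scale0r.
Qed.

(* Euler transform of the geometric sequence of ratio - s (1 - r) / r *)
Lemma bser_mul P r s : 0 < r < 1 -> 0 <= s < 1 ->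
  bser P (1 - (1 - r) * (1 - s)) = bser P r *m bser P s.
Proof.
move=> /andP[r0 r1] s01; have /andP[s0 s1] := s01.
have r01 : 0 <= r < 1 by rewrite ltW.
have rn : r != 0 by rewrite gt_eqF.
have r1n : 1 - r != 0 by rewrite subr_eq0 gt_eqF.
have t01 : 0 <= 1 - (1 - r) * (1 - s) < 1 by apply/andP; split; nra.
pose y : K := - (s * (1 - r) / r).
pose c k : M := (y%:C ^+ k)%:M.
have dE k : euler_dom c P r k = (s ^+ k)%:C *: pochf P k.
  rewrite /euler_dom /c mul_mx_scalar; move: (pochf P k) => W.
  rewrite scalerA -rmorphXn -rmorphM -exprMn /=; congr (_ %:C *: _).
  by congr (_ ^+ _); rewrite /y; field; rewrite rn r1n.
have iE m : euler_im c P r m = ((1 - (1 - r) * (1 - s)) ^+ m)%:C *: pochf P m.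
  rewrite /euler_im /bintr pev_geometric mul_mx_scalar; move: (pochf P m) => W.
  rewrite horner_exp hornerD hornerN hornerX hornerC.
  rewrite -(rmorph1 (real_complex K)) -rmorphB -rmorphXn scalerA -rmorphM -exprMn /=.
  congr (_ %:C *: _); congr (_ ^+ _).
  by rewrite /y; field.
have cv : cvgn (series (fun k => l1 (euler_dom c P r k))).
  have a0 k : 0 <= l1 (poch P k) / k`!%:R by rewrite divr_ge0 ?l1_ge0.
  suff -> : (fun k => l1 (euler_dom c P r k)) =
      fun k => l1 (poch P k) / k`!%:R * s ^+ k.
    exact: subexp_summable a0 (poch_subexp P) s01.
  by apply/funext => k; rewrite dE l1Z ger0_norm ?exprn_ge0 // l1_pochf mulrC.
have := euler_transform_abs r01 cv.
have -> : limn (series (euler_dom c P r)) = bser P s.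
  by rewrite /bser; congr (limn (series _)); apply/funext.
have -> : euler_im c P r =
    fun m => ((1 - (1 - r) * (1 - s)) ^+ m)%:C *: pochf P m by apply/funext.
exact: mcvg_unique (bserP P t01).
Qed.

Lemma bser_expN P (h : K) j : 0 < h ->
  bser P (1 - expR (- (h * j%:R))) = bser P (1 - expR (- h)) ^+ j.
Proof.
move=> h0; have e01 (x : K) : 0 <= x -> 0 <= 1 - expR (- x) < 1.
  by move=> x0; rewrite subr_ge0 -expR0 ler_expR oppr_le0 x0 ltrBlDr ltrDl expR_gt0.
have eh : 0 < 1 - expR (- h) < 1.
  by rewrite subr_gt0 -expR0 ltr_expR oppr_lt0 h0 ltrBlDr ltrDl expR_gt0.
elim: j => [|j ih]; first by rewrite mulr0 oppr0 expR0 subrr bser0 expr0.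
rewrite exprS -ih -[RHS]/(_ *m _) -bser_mul ?e01 ?mulr_ge0 ?(ltW h0) //.
congr bser; congr (1 - _); rewrite !subKr -expRD; congr expR.
by rewrite -[j.+1]addn1 natrD mulrDr mulr1 opprD addrC.
Qed.

Lemma bser_quadratic P r : 0 < r < 1 -> exists C, forall s, 0 <= s <= r ->
  l1 (bser P s - (1%:M + s%:C *: P)) <= C * s ^+ 2.
Proof.
move=> /andP[r0 r1]; have r01 : 0 <= r < 1 by rewrite ltW.
have a0 k : 0 <= l1 (poch P k) / k`!%:R by rewrite divr_ge0 ?l1_ge0.
have cv := subexp_summable a0 (poch_subexp P) r01.
set f := fun m => l1 (poch P m) / m`!%:R * r ^+ m in cv.
exists (limn (series f) / r ^+ 2) => s /andP[s0 sr].
have s01 : 0 <= s < 1 by rewrite s0 (le_lt_trans sr).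
apply: mcvg_le (bserP P s01); exists 2%N => // -[//|[//|n]] _.
rewrite /series /= !big_nat_recl // expr0 expr1 pochf0 pochf1 scale1r addrA.
rewrite [_ + s%:C *: P + _]addrC addrK (le_trans (l1_sum _ _ _)) //.
have nd : nondecreasing_seq (series f).
  by apply: nondecreasing_series => k _ _; rewrite mulr_ge0 // exprn_ge0 // ltW.
apply: (@le_trans _ _ (\sum_(0 <= k < n) f k.+2 / r ^+ 2 * s ^+ 2)).
  apply: ler_sum => k _; rewrite l1Z ger0_norm ?exprn_ge0 // l1_pochf mulrC.
  have xk (x : K) : x ^+ k.+2 = x ^+ k * x ^+ 2 by rewrite -exprD addn2.
  have -> : f k.+2 / r ^+ 2 * s ^+ 2 = l1 (poch P k.+2) / k.+2`!%:R * (r ^+ k * s ^+ 2).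
    by rewrite /f xk [_ * (_ * r ^+ 2)]mulrA mulfK ?expf_neq0 ?gt_eqF // -mulrA.
  rewrite ler_wpM2l // xk ler_wpM2r ?exprn_ge0 //.
  by rewrite lerXn2r // nnegrE // ltW.
rewrite -!mulr_suml ler_wpM2r ?exprn_ge0 // ler_wpM2r ?invr_ge0 ?exprn_ge0 ?(ltW r0) //.
apply: le_trans (nondecreasing_cvgn_le nd cv n.+2).
rewrite /series /= [leRHS]big_nat_recl // [X in _ <= _ + X]big_nat_recl // addrA lerDr.
by rewrite addr_ge0 // mulr_ge0 // exprn_ge0 // ltW.
Qed.

Lemma bser_mexp P r : 0 < r < 1 -> bser P r = mexp ((- ln (1 - r))%:C *: P).
Proof.
move=> r01; have /andP[r0 r1] := r01; set L := - ln (1 - r).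
have rE : r = 1 - expR (- L) by rewrite opprK lnK ?subKr // posrE subr_gt0.
have L0 : 0 < L by rewrite oppr_gt0 ln_lt0 // subr_gt0 r1 ltrBlDr ltrDl.
pose h n : K := L / n.+1%:R; pose s n := 1 - expR (- h n).
have h0 n : 0 < h n by rewrite divr_gt0.
have sb n : h n / (1 + h n) <= s n <= h n.
  have e1 := expR_ge1Dx (- h n); have e2 := expR_ge1Dx (h n).
  have e3 : expR (- h n) <= (1 + h n)^-1.
    by rewrite expRN lef_pV2 // ?posrE ?expR_gt0 // addr_gt0.
  have e4 : h n / (1 + h n) = 1 - (1 + h n)^-1.
    by field; rewrite gt_eqF // addr_gt0.
  by rewrite /s e4; apply/andP; split; lra.
have [C bC] := bser_quadratic P r01.
have sr n : 0 <= s n <= r.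
  have /andP[s1 _] := sb n; rewrite (le_trans _ s1) /=; last first.
    by rewrite divr_ge0 ?addr_ge0 // ltW.
  rewrite rE lerD2l lerN2 ler_expR lerN2 /h ler_pdivrMr // ler_peMr ?(ltW L0) //.
  by rewrite ler1n.
pose X n : M := n.+1%:R *: (bser P (s n) - 1%:M).
have XL : mcvg X (L%:C *: P).
  pose b n := `|C| * (L ^+ 2 * harmonic n) + (L ^+ 2 * harmonic n) * l1 P.
  have bn : (b @ \oo --> (0 : K))%classic.
    have hL : (L ^+ 2 * harmonic n @[n --> \oo] --> (0 : K))%classic.
      rewrite -(mulr0 (L ^+ 2)); apply: cvgM; [exact: cvg_cst|exact: cvg_harmonic].
    have -> : (0 : K) = `|C| * 0 + 0 * l1 P by rewrite mulr0 mul0r addr0.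
    by apply: cvgD; apply: cvgM => //; exact: cvg_cst.
  apply: mcvg_squeeze bn => n; have /andP[s0 _] := sr n; have /andP[s1 s2] := sb n.
  have n0 : 0 < n.+1%:R :> K by [].
  have hn : n.+1%:R * h n = L by rewrite /h mulrC divfK // gt_eqF.
  have hh : n.+1%:R * (h n) ^+ 2 = L ^+ 2 * harmonic n.
    by rewrite /h /harmonic /=; field; rewrite gt_eqF.
  have -> : X n - L%:C *: P = n.+1%:R *: (bser P (s n) - (1%:M + (s n)%:C *: P)) +
      (n.+1%:R * s n - L)%:C *: P.
    have -> : (n.+1%:R * s n - L)%:C = n.+1%:R * (s n)%:C - L%:C :> K[i].
      by rewrite natrC -rmorphM -rmorphB.
    rewrite /X; move: (bser P (s n)) => B; rewrite scalerBl addrA; congr (_ - _).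
    by rewrite -scalerA -scalerDr opprD addrA subrK.
  rewrite (le_trans (l1D _ _)) // l1Zn l1Z /b lerD //.
    apply: (@le_trans _ _ (n.+1%:R * (`|C| * (s n) ^+ 2))).
      rewrite ler_wpM2l // (le_trans (bC _ (sr n))) // ler_wpM2r ?sqr_ge0 //.
      exact: ler_norm.
    rewrite mulrCA ler_wpM2l // -hh ler_wpM2l // lerXn2r ?nnegrE //.
    exact: ltW.
  rewrite ler_wpM2r ?l1_ge0 // ler0_norm; last first.
    by rewrite subr_le0 -hn ler_wpM2l.
  rewrite opprB -hh -[X in X - _]hn -mulrBr ler_wpM2l //.
  have e5 : h n - h n / (1 + h n) = (h n) ^+ 2 / (1 + h n).
    by field; rewrite gt_eqF // addr_gt0.
  apply: (@le_trans _ _ (h n - h n / (1 + h n))); first by rewrite lerD2l lerN2.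
  rewrite e5 ler_piMr ?sqr_ge0 // invf_le1 ?addr_gt0 //.
  by rewrite lerDl ltW.
apply: mcvg_unique (mcvg_exp XL).
apply: mcvg_eq (mcvg_cst (bser P r)) => n.
have -> : 1 + (n.+1%:R^-1)%:C *: X n = bser P (s n).
  rewrite /X natrC scalerA -rmorphM mulVf ?pnatr_eq0 // rmorph1 scale1r.
  by rewrite -[1]/(1%:M) addrC subrK.
by rewrite -bser_expN // /h divfK ?pnatr_eq0 // -rE.
Qed.

End BinomialSeriesExp.

(** * Pochhammer symbols that vanish *)

Section Eigen.
Variables (K : realType) (N : nat).
Local Notation M := 'M[K[i]]_N.
Implicit Types (A B P W : M) (u v c d : nat -> M) (m j k n : nat) (x y r s : K).

Lemma unitmx_eigenvalue A (a : K[i]) : ~~ eigenvalue A a -> A - a%:M \in unitmx.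
Proof. by rewrite /eigenvalue negbK /eigenspace kermx_eq0 row_free_unit. Qed.

Lemma positive_stable_unit A k : positive_stable A -> A + k%:R%:M \in unitmx.
Proof.
move=> sA; have -> : A + k%:R%:M = A - (- k%:R)%:M by rewrite raddfN /= opprK.
apply/unitmx_eigenvalue/negP => /sA; rewrite natrC raddfN /=.
by rewrite oppr_gt0 ltNge ler0n.
Qed.

Lemma half_shift_unit A j k : positive_stable A ->
  2^-1 *: (A + j%:R%:M) + k%:R%:M \in unitmx.
Proof.
move=> sA; have -> : 2^-1 *: (A + j%:R%:M) + k%:R%:M =
    2^-1 *: (A + (j + 2 * k)%:R%:M) :> M.
  have -> : (j + 2 * k)%:R%:M = j%:R%:M + 2 *: k%:R%:M :> M.
    by rewrite natrD raddfD natrM scale_scalar_mx.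
  by rewrite addrA [RHS]scalerDr scalerA mulVf ?scale1r // pnatr_eq0.
by rewrite unitmxZ ?positive_stable_unit // unitfE invr_eq0 pnatr_eq0.
Qed.

Lemma shift_unit_large A : exists n, forall k, A + n%:R%:M + k%:R%:M \in unitmx.
Proof.
have [p Ap] := l1_bound A; exists p.+2 => k.
rewrite -addrA -raddfD -natrD /=; set a := (p.+2 + k)%N.
have -> : A + a%:R%:M = A - (- a%:R)%:M by rewrite raddfN /= opprK.
apply/unitmx_eigenvalue/negP => /eigenvalueP[v vA /negP v0]; apply: v0; apply/eqP/l1_eq0.
have : l1 (a%:R *: v) <= l1 v * p.+1%:R.
  by rewrite -l1N -scaleNr -vA (le_trans (l1M _ _)) // ler_wpM2l // l1_ge0.
rewrite natrC l1Z ger0_norm // mulrC -subr_ge0 -mulrBr => h.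
have a1 : p.+1%:R + 1%:R <= a%:R :> K by rewrite -natrD ler_nat /a; lia.
have l0 := l1_ge0 v.
apply: le_anti; rewrite l1_ge0 andbT; nra.
Qed.

Lemma subexp_shift (f : nat -> K) n : (forall m, 0 <= f m) -> subexp f ->
  subexp (fun j => f (n + j)%N).
Proof.
move=> f0 sf r /andP[r0 r1]; pose r' := (1 + r) / 2.
have r'0 : 0 < r' by rewrite divr_gt0 // ltr_wpDr.
have r'1 : r' < 1 by rewrite /r'; lra.
have rr' : r <= r' by rewrite /r'; lra.
have r'01 : 0 <= r' < 1 by rewrite ltW.
have [C fC] := sf r' r'01; exists (C / r' ^+ n) => j.
rewrite ler_pdivlMr ?exprn_gt0 // (le_trans _ (fC (n + j)%N)) //.
rewrite exprD -mulrA ler_wpM2l // mulrC ler_wpM2l ?exprn_ge0 ?(ltW r'0) //.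
by rewrite lerXn2r // nnegrE // ltW.
Qed.

Lemma subexp_fact n : subexp (fun j => (n + j)`!%:R / j`!%:R : K).
Proof.
apply: (@subexp_ratio _ _ n.+1) => [j|j nj]; first by rewrite divr_ge0.
have f0 : 0 < j`!%:R :> K by rewrite ltr0n fact_gt0.
rewrite addnS !factS !natrM.
have -> : (n + j).+1%:R * (n + j)`!%:R / (j.+1%:R * j`!%:R) =
    (n + j).+1%:R / j.+1%:R * ((n + j)`!%:R / j`!%:R) :> K.
  by rewrite invfM mulrACA.
have X0 : 0 <= (n + j)`!%:R / j`!%:R :> K by rewrite divr_ge0.
move: (_ / j`!%:R) X0 => X X0; rewrite mulrA ler_wpM2r // mulrA ler_pdivrMr //.
have h1 : (n + j).+1%:R <= j%:R + n.+1%:R :> K by rewrite -natrD ler_nat; lia.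
have h2 : j%:R - n.+1%:R <= j.+1%:R :> K.
  by rewrite lerBlDr -natrD ler_nat; lia.
have h3 : 0 <= (n + j).+1%:R :> K by [].
have h4 : 0 <= j.+1%:R :> K by [].
by rewrite [leRHS]mulrC [leLHS]mulrC -[leLHS]mulrC ler_pM // subr_ge0 ler_nat ltnW.
Qed.

Lemma poch_eventually0 P c d x F : 1 < x ->
  (forall k, c k *m d k = 1%:M) -> subexp (fun k => l1 (d k)) ->
  mcvg (series (fun k => (x ^+ k)%:C *: (pochf P k *m c k))) F ->
  exists n, poch P n = 0.
Proof.
move=> x1 cd sd xF; have [C C0 bC] := mcvg_series_bounded xF.
have x0 : 0 < x by rewrite (lt_trans _ x1).
have [n Pn] := shift_unit_large P; exists n; apply: l1_eq0.
pose e j := j`!%:R * l1 (invmx (poch (P + n%:R%:M) j)).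
have e0 j : 0 <= e j by rewrite mulr_ge0 ?l1_ge0.
pose g j : K := (n + j)`!%:R / j`!%:R.
have g0 j : 0 <= g j by rewrite divr_ge0.
have d0 j : 0 <= l1 (d j) by exact: l1_ge0.
have gd0 j : 0 <= g j * l1 (d (n + j)%N) by rewrite mulr_ge0.
pose f j := g j * l1 (d (n + j)%N) * e j.
have f0 j : 0 <= f j by rewrite mulr_ge0.
have sf : subexp f.
  apply: subexpM => //; last exact: (poch_inv_subexp Pn).
  by apply: subexpM => //; [exact: subexp_fact|exact: (@subexp_shift (fun j => l1 (d j)))].
have xV : 0 <= x^-1 < 1 by rewrite invr_ge0 (ltW x0) invf_lt1.
have /cvg_series_cvg_0 lim0 := subexp_summable f0 sf xV.
have bound j : l1 (poch P n) <= C * x ^- n * (f j * x^-1 ^+ j).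
  have -> : poch P n = (n + j)`!%:R *: (pochf P (n + j) *m c (n + j)%N) *m
      d (n + j)%N *m invmx (poch (P + n%:R%:M) j).
    rewrite -scalemxAl -(mulmxA _ _ (d _)) cd mulmx1 /pochf scalerA mulfV.
      by rewrite scale1r poch_add mulmxK // poch_unit.
    by rewrite pnatr_eq0 -lt0n fact_gt0.
  rewrite (le_trans (l1M _ _)) // (le_trans (ler_wpM2r _ (l1M _ _))) ?l1_ge0 // l1Zn.
  have -> : C * x ^- n * (f j * x^-1 ^+ j) =
      (n + j)`!%:R * (C * x ^- (n + j)) * l1 (d (n + j)%N) *
      l1 (invmx (poch (P + n%:R%:M) j)).
    rewrite /f /g /e exprVn exprD invfM; field.
    by rewrite !expf_neq0 ?gt_eqF // ltr0n fact_gt0.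
  rewrite ler_wpM2r ?l1_ge0 // ler_wpM2r // ler_wpM2l //.
  rewrite ler_pdivlMr ?exprn_gt0 // mulrC.
  by have := bC (n + j)%N; rewrite l1Z ger0_norm ?exprn_ge0 // ltW.
apply: le_anti; rewrite l1_ge0 andbT; apply/ler_addgt0Pr => eps eps0; rewrite add0r.
have D0 : 0 < C * x ^- n + 1.
  by rewrite ltr_wpDl // mulr_ge0 // invr_ge0 exprn_ge0 // ltW.
have /cvgrPdist_le/(_ (eps / (C * x ^- n + 1))) := lim0.
rewrite divr_gt0 // => /(_ isT)[j _ /(_ j (leqnn _))] /=.
have t0 : 0 <= f j * x^-1 ^+ j by rewrite mulr_ge0 // exprn_ge0 // invr_ge0 ltW.
rewrite sub0r normrN ger0_norm // => h.
rewrite (le_trans (bound j)) // mulrC.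
move: h; rewrite ler_pdivlMr // mulrDr mulr1 => h.
by apply: le_trans h; rewrite lerDl.
Qed.

Lemma eigen_pochf P W n k : W *m (P + n%:R%:M) = 0 ->
  W *m pochf P k = ((-1) ^+ k * 'C(n, k)%:R) *: W.
Proof.
move=> WP.
suff h : W *m poch P k = (k`!%:R * ((-1) ^+ k * 'C(n, k)%:R)) *: W.
  have f0 : k`!%:R != 0 :> K[i] by rewrite pnatr_eq0 -lt0n fact_gt0.
  by rewrite /pochf -scalemxAr h scalerA mulKf.
elim: k => [|k ih].
  by rewrite poch0 mulmx1 fact0 expr0 bin0 !mulr1 scale1r.
have WPk : W *m (P + k%:R%:M) = (k%:R - n%:R) *: W.
  have -> : P + k%:R%:M = (P + n%:R%:M) + (k%:R - n%:R)%:M.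
    by rewrite raddfB /= [RHS]addrCA addrK addrC.
  by rewrite mulmxDr WP add0r mul_mx_scalar.
rewrite pochS mulmxA ih -scalemxAl WPk scalerA; congr (_ *: _).
have e : k.+1%:R * 'C(n, k.+1)%:R = (n%:R - k%:R) * 'C(n, k)%:R :> K[i].
  rewrite -natrM mul_bin_left; have [kn|nk] := leqP k n; first by rewrite natrM natrB.
  by rewrite bin_small // muln0 mulr0.
rewrite factS natrM exprS mulrCA -!mulrA mulrCA [k.+1%:R * _]mulrCA.
have -> : k.+1%:R * (-1 * ((-1) ^+ k * 'C(n, k.+1)%:R)) =
  -1 * (-1) ^+ k * (k.+1%:R * 'C(n, k.+1)%:R) :> K[i] by ring.
by rewrite e; ring.
Qed.

Lemma eigen_series P W c n x : W *m (P + n%:R%:M) = 0 ->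
  mcvg (fun j => W *m series (fun k => (x ^+ k)%:C *: (pochf P k *m c k)) j)
    (W *m pev c ((1 - x%:C *: 'X) ^+ n)).
Proof.
move=> WP.
have -> : pev c ((1 - x%:C *: 'X) ^+ n) =
    \sum_(0 <= k < n.+1) (x%:C ^+ k * ((-1) ^+ k * 'C(n, k)%:R)) *: c k.
  rewrite big_mkord exprDn linear_sum; apply: eq_bigr => k _.
  rewrite expr1n mul1r -scaler_nat linearZ /= -scaleNr exprZn linearZ /= pevXn.
  by rewrite scalerA -mulN1r exprMn; congr (_ *: _); ring.
have term k : W *m ((x ^+ k)%:C *: (pochf P k *m c k)) =
    W *m ((x%:C ^+ k * ((-1) ^+ k * 'C(n, k)%:R)) *: c k).
  rewrite -scalemxAr mulmxA (eigen_pochf k WP) -scalemxAl scalerA -scalemxAr.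
  by rewrite rmorphXn.
apply/mcvgP => e e0; exists n.+1 => j nj.
rewrite (_ : _ - _ = 0) ?l10 ?(ltW e0) //; apply/eqP; rewrite subr_eq0; apply/eqP.
rewrite /series /= (big_cat_nat (leq0n _) nj) /= mulmxDr !mulmx_sumr.
rewrite [X in _ + X]big_nat [X in _ + X]big1 ?addr0 => [|k /andP[nk _]].
  by apply: eq_bigr => k _; exact: term.
by rewrite term bin_small // !mulr0 scale0r mulmx0.
Qed.

End Eigen.

(** * Principal powers *)

Section Power.
Variables (K : realType) (N : nat).
Local Notation M := 'M[K[i]]_N.
Implicit Types (A B P W D : M) (m j k n : nat) (x y r s : K).

Lemma clog_gt0 y : 0 < y -> clog y%:C = (ln y)%:C.
Proof.
move=> y0; rewrite /clog /carg normc_def /= lexx expr0n addr0 sqrtr_sqr gtr0_norm //.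
by rewrite divff ?gt_eqF // acos1.
Qed.

Lemma clog_lt0 y : y < 0 -> clog y%:C = ln (- y) +i* pi.
Proof.
move=> y0; rewrite /clog /carg normc_def /= lexx expr0n addr0 sqrtr_sqr ltr0_norm //.
by rewrite invrN mulrN divff ?lt_eqF // acosN1.
Qed.

Lemma imag_exp y k : (0 +i* y) ^+ k =
  ((~~ odd k)%:R * (-1) ^+ k./2 * y ^+ k) +i* ((odd k)%:R * (-1) ^+ k.-1./2 * y ^+ k)
  :> K[i].
Proof.
have sq m : (0 +i* y) ^+ m.*2 = ((-1) ^+ m * y ^+ m.*2)%:C :> K[i].
  rewrite -mul2n exprM; have -> : (0 +i* y) ^+ 2 = (- y ^+ 2)%:C :> K[i].
    by rewrite expr2; apply/eqP; rewrite eq_complex /=; apply/andP; split; apply/eqP; ring.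
  by rewrite -rmorphXn (exprNn (y ^+ 2)) exprM.
rewrite -(odd_double_half k); set m := k./2; case: (odd k) => /=.
  rewrite add1n exprS sq /= odd_double /= doubleK.
  rewrite -[m.*2.+1]/(1 + m.*2)%N exprD expr1.
  by apply/eqP; rewrite eq_complex /=; apply/andP; split; apply/eqP; ring.
rewrite add0n sq odd_double /= doubleK.
by apply/eqP; rewrite eq_complex /=; apply/andP; split; apply/eqP; ring.
Qed.

Lemma eigen_exp P W n (z : K[i]) k : W *m (P + n%:R%:M) = 0 ->
  W *m (k`!%:R^-1 *: (z *: P) ^+ k) = ((- n%:R * z) ^+ k / k`!%:R) *: W.
Proof.
move=> WP; have WPn : W *m P = (- n%:R) *: W.
  by apply/eqP; rewrite scaleNr -addr_eq0 -mul_mx_scalar -mulmxDr WP.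
rewrite -scalemxAr [_ / _]mulrC -scalerA; congr (_ *: _).
elim: k => [|k ih]; first by rewrite !expr0 scale1r mulmx1.
rewrite exprSr -[_ * _]/(_ *m _) mulmxA ih -scalemxAl -scalemxAr WPn !scalerA.
by congr (_ *: _); rewrite exprSr; ring.
Qed.

Lemma eigen_mexp_real P W n s : W *m (P + n%:R%:M) = 0 ->
  W *m mexp (s%:C *: P) = (expR (- n%:R * s))%:C *: W.
Proof.
move=> WP; apply: mcvg_unique (mcvgMl W (mexpP (s%:C *: P))) _.
have lim := mcvgZ (is_cvg_series_exp_coeff (- n%:R * s)) (mcvg_cst W).
apply: mcvg_eq lim => j; rewrite /series /= mulmx_sumr rmorph_sum scaler_suml.
apply: eq_bigr => k _; rewrite (eigen_exp _ _ WP); congr (_ *: _).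
by rewrite /exp_coeff /= !natrC -rmorphN -rmorphM -rmorphXn -fmorphV -rmorphM.
Qed.

Lemma eigen_mexp_pi P W n : W *m (P + n%:R%:M) = 0 ->
  W *m mexp ((0 +i* pi) *: P) = ((-1) ^+ n)%:C *: W.
Proof.
move=> WP; pose y : K := - n%:R * pi.
have cosy : cos y = (-1) ^+ n.
  rewrite /y mulNr cosN; elim: (n) => [|m ih]; first by rewrite mul0r cos0.
  by rewrite -addn1 natrD mulrDl mul1r cosDpi ih addn1 exprS mulN1r.
have siny : sin y = 0.
  rewrite /y mulNr sinN; apply/eqP; rewrite oppr_eq0; apply/eqP.
  elim: (n) => [|m ih]; first by rewrite mul0r sin0.
  by rewrite -addn1 natrD mulrDl mul1r sinDpi ih oppr0.
apply: mcvg_unique (mcvgMl W (mexpP _)) _.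
have cl := @is_cvg_series_cos_coeff K y; have sl := @is_cvg_series_sin_coeff K y.
have lim := mcvgD (mcvgZ cl (mcvg_cst W)) (mcvgZ sl (mcvg_cst ((0 +i* 1) *: W))).
have cosE : limn (series (cos_coeff y)) = (-1) ^+ n by rewrite -cosy unlock.
have sinE : limn (series (sin_coeff y)) = 0 by rewrite -siny unlock.
rewrite cosE sinE scale0r addr0 in lim.
apply: mcvg_eq lim => j; rewrite /series /= mulmx_sumr !rmorph_sum !scaler_suml.
rewrite -big_split /=; apply: eq_bigr => k _; rewrite (eigen_exp _ _ WP).
rewrite scalerA -scalerDl; congr (_ *: _).
have -> : - n%:R * (0 +i* pi) = 0 +i* y :> K[i].
  rewrite natrC; apply/eqP; rewrite eq_complex /=.
  by apply/andP; split; apply/eqP; rewrite /y; ring.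
rewrite imag_exp natrC -fmorphV cos_coeffE sin_coeffE.
by apply/eqP; rewrite eq_complex /=; apply/andP; split; apply/eqP; ring.
Qed.

Lemma eigen_mpow P W n y : y < 0 -> W *m (P + n%:R%:M) = 0 ->
  W *m mpow y%:C P = (y ^- n)%:C *: W.
Proof.
move=> y0 WP; rewrite /mpow clog_lt0 //.
have -> : ln (- y) +i* pi = (ln (- y))%:C + (0 +i* pi) :> K[i].
  by apply/eqP; rewrite eq_complex /= addr0 add0r !eqxx.
rewrite scalerDl mexpD; last by rewrite /comm_mx -!scalemxAl -!scalemxAr !scalerA mulrC.
rewrite mulmxA (eigen_mexp_real _ WP) -scalemxAl (eigen_mexp_pi WP) scalerA -rmorphM /=.
congr (_%:C *: _); rewrite mulNr expRN expRM_natl lnK ?posrE ?oppr_gt0 //.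
have -> : y ^+ n = (-1) ^+ n * (- y) ^+ n by rewrite -exprMn mulN1r opprK.
by rewrite invfM -[((-1) ^+ n)^-1]exprVn invrN1 mulrC.
Qed.

(* Modulo [P + m], the matrix [poch P m] is the nonzero scalar (-m)_m. *)
Lemma poch_kernel P D :
  (forall n W, W *m (P + n%:R%:M) = 0 -> W *m D = 0) ->
  forall m W, W *m poch P m = 0 -> W *m D = 0.
Proof.
move=> PD; elim=> [|m ih] W; first by rewrite poch0 mulmx1 => ->; rewrite mul0mx.
move=> Wm; have WD : W *m poch P m *m D = 0.
  by apply: (PD m); rewrite -mulmxA -pochS.
have cPm : comm_mx P (P + m%:R%:M) by exact/comm_mx_shift/comm_mx_refl.
have key k : exists2 Q, comm_mx P Q & poch P k =
    (P + m%:R%:M) *m Q + (\prod_(j < k) (j%:R - m%:R))%:M.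
  elim: k => [|k [Q PQ QE]].
    by exists 0; rewrite ?big_ord0 ?poch0 ?mulmx0 ?add0r //; exact: comm_mx0.
  pose a : K[i] := \prod_(j < k) (j%:R - m%:R).
  exists (Q *m (P + k%:R%:M) + a%:M).
    apply: comm_mxD; last exact: comm_mx_scalar.
    by apply: comm_mxM => //; exact/comm_mx_shift/comm_mx_refl.
  have Yk : P + k%:R%:M = (P + m%:R%:M) + (k%:R - m%:R)%:M.
    by rewrite raddfB /= [RHS]addrCA addrK addrC.
  rewrite pochS QE big_ord_recr /= -/a.
  move: (P + m%:R%:M) (P + k%:R%:M) Yk => X Y YE.
  rewrite mulmxDl mulmxDr mulmxA -addrA; congr (_ + _).
  by rewrite YE mulmxDr -scalar_mxM scalar_mxC.
have [Q PQ QE] := key m; set a := \prod_(k < m) _ in QE.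
have a0 : a != 0.
  apply/prodf_neq0 => k _; rewrite subr_eq0 eqr_nat.
  by rewrite neq_ltn ltn_ord.
have W'D : W *m ((P + m%:R%:M) *m Q) *m D = 0.
  apply: ih; have cQ : Q *m poch P m = poch P m *m Q.
    exact/comm_mx_poch/comm_mx_sym.
  rewrite -!mulmxA cQ (mulmxA (P + _)).
  have -> : (P + m%:R%:M) *m poch P m = poch P m *m (P + m%:R%:M).
    by apply/comm_mx_poch/comm_mx_sym.
  by rewrite -pochS mulmxA Wm mul0mx.
have : a *: (W *m D) = 0.
  by rewrite scalemxAl -mul_mx_scalar -WD QE mulmxDr mulmxDl W'D add0r.
by move/eqP; rewrite scaler_eq0 (negPf a0) => /eqP.
Qed.

End Power.

(** * The transformation formula *)

Section Transformation.
Variables (K : realType) (N : nat).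
Local Notation M := 'M[K[i]]_N.
Implicit Types (A B P : M) (c d : nat -> M) (w x : K).

Definition pochq A B k : M := poch A k *m invmx (poch B k).

Lemma comm_poch A B j k : comm_mx A B -> comm_mx (poch A j) (poch B k).
Proof. by move=> AB; apply/comm_mx_poch/comm_mx_sym/comm_mx_poch/comm_mx_sym. Qed.

Lemma pochq_subexp A B : (forall k, B + k%:R%:M \in unitmx) ->
  subexp (fun k => l1 (pochq A B k)).
Proof.
move=> uB; apply: (@subexp_le _ _ (fun k =>
    (l1 (poch A k) / k`!%:R) * (k`!%:R * l1 (invmx (poch B k))))).
  move=> k; have f0 : k`!%:R != 0 :> K by rewrite pnatr_eq0 -lt0n fact_gt0.
  by rewrite mulrA divfK // l1M.
apply: subexpM; [| |exact: poch_subexp|exact: poch_inv_subexp] => k.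
  by rewrite divr_ge0 ?l1_ge0.
by rewrite mulr_ge0 ?l1_ge0.
Qed.

Lemma pochqK A B k : (forall j, A + j%:R%:M \in unitmx) ->
  (forall j, B + j%:R%:M \in unitmx) -> pochq A B k *m pochq B A k = 1%:M.
Proof.
move=> uA uB; rewrite /pochq -mulmxA (mulmxA (invmx _)) mulVmx ?poch_unit //.
by rewrite mul1mx mulmxV ?poch_unit.
Qed.

Lemma subexp_pow_cvgn (u v : nat -> M) x : `|x| < 1 ->
  subexp (fun k => l1 (v k)) -> (forall k, u k = (x ^+ k)%:C *: v k) ->
  cvgn (series u).
Proof.
move=> x1 sv uv; have x01 : 0 <= `|x| < 1 by rewrite normr_ge0.
have cv := subexp_summable (fun k => l1_ge0 (v k)) sv x01.
apply: mcvg_cvgn (is_mcvg_series_le _ cv) => k.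
by rewrite uv l1Z normrX mulrC.
Qed.

Lemma pochf_subexp P c : subexp (fun k => l1 (c k)) ->
  subexp (fun k => l1 (pochf P k *m c k)).
Proof.
move=> sc; apply: (@subexp_le _ _ (fun k => l1 (poch P k) / k`!%:R * l1 (c k))).
  by move=> k; rewrite -l1_pochf l1M.
apply: subexpM => [k|k||//]; [by rewrite divr_ge0 ?l1_ge0|exact: l1_ge0|].
exact: poch_subexp.
Qed.

Lemma mpow_gt0 P x : 0 < x -> mpow x%:C P = mexp ((ln x)%:C *: P).
Proof. by move=> x0; rewrite /mpow clog_gt0. Qed.

Variables (P : M) (c d : nat -> M) (w : K) (F G : M).
Hypotheses (w0 : w != 0) (w1 : w != -1).
Hypotheses (cd : forall k, c k *m d k = 1%:M) (sd : subexp (fun k => l1 (d k))).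
Hypothesis cF :
  mcvg (series (fun k => ((w + 1)^-1 ^+ k)%:C *: (pochf P k *m c k))) F.
Hypothesis cG :
  mcvg (series (fun k => ((- w^-1) ^+ k)%:C *: (pochf P k *m bintr c k))) G.

Lemma euler_pos : 0 < w -> F = mpow ((w + 1) / w)%:C P *m G.
Proof.
move=> wp; have w1p : 0 < w + 1 by rewrite addr_gt0.
have wn : w + 1 != 0 by rewrite gt_eqF.
have z01 : 0 < (w + 1)^-1 < 1.
  by rewrite invr_gt0 w1p invf_lt1 // ltrDr.
have z01' : 0 <= (w + 1)^-1 < 1 by case/andP: z01 => /ltW -> ->.
have zE : 1 - (w + 1)^-1 = ((w + 1) / w)^-1 by field; rewrite w0 wn.
rewrite mpow_gt0 ?divr_gt0 //.
have -> : ln ((w + 1) / w) = - ln (1 - (w + 1)^-1).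
  by rewrite zE lnV ?opprK // posrE divr_gt0.
rewrite -bser_mexp //; apply: (@euler_transform _ _ P (bintr c) _ G F z01').
  apply: mcvg_eq cG => n; apply: eq_bigr => k _; rewrite /euler_dom.
  by congr (_%:C *: _); congr (_ ^+ k); rewrite zE; field; rewrite w0 wn.
apply: mcvg_eq cF => n; apply: eq_bigr => k _.
by rewrite /euler_im bintrK.
Qed.

Lemma euler_neg : w < -1 -> F = mpow ((w + 1) / w)%:C P *m G.
Proof.
move=> wn; have w0' : w < 0 by rewrite (lt_trans wn) // oppr_lt0.
have w1n : w + 1 < 0 by rewrite -ltrBrDr sub0r.
have wn1 : w + 1 != 0 by rewrite lt_eqF.
have r01 : 0 < - w^-1 < 1.
  by rewrite oppr_gt0 invr_lt0 w0' -invrN invf_lt1 ?oppr_gt0 // ltrNr.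
have r01' : 0 <= - w^-1 < 1 by case/andP: r01 => /ltW -> ->.
have rE : 1 - - w^-1 = (w + 1) / w by field.
have y0 : 0 < (w + 1) / w by rewrite -mulrNN -invrN divr_gt0 // oppr_gt0.
have := @euler_transform _ _ P c _ F G r01'.
rewrite bser_mexp // rE mpow_gt0 // => -> //.
  rewrite mulmxA rmorphN scaleNr mexpN mul1mx //.
apply: mcvg_eq cF => n; apply: eq_bigr => k _; rewrite /euler_dom rE.
congr (_%:C *: _); congr (_ ^+ k); field; by rewrite w0 wn1.
Qed.

Lemma euler_terminating : -1 < w < 0 -> F = mpow ((w + 1) / w)%:C P *m G.
Proof.
move=> /andP[wm wn]; have w1p : 0 < w + 1 by rewrite -ltrBlDr sub0r.
have wn1 : w + 1 != 0 by rewrite gt_eqF.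
have z1 : 1 < (w + 1)^-1 by rewrite invf_gt1 // gtrDr.
have [n Pn] := poch_eventually0 z1 cd sd cF.
have y0 : (w + 1) / w < 0 by rewrite pmulr_rlt0 // invr_lt0.
apply/eqP; rewrite -subr_eq0; apply/eqP.
rewrite -[LHS]mul1mx; apply: (@poch_kernel _ _ P _ _ n); last by rewrite mul1mx.
move=> {Pn n} n W WP; rewrite mulmxBr mulmxA (eigen_mpow y0 WP) -scalemxAl.
have := mcvg_unique (mcvgMl W cF) (eigen_series c _ WP) => ->.
have := mcvg_unique (mcvgMl W cG) (eigen_series (bintr c) _ WP) => ->.
rewrite pev_comp scalemxAr -linearZ /=; apply/eqP; rewrite subr_eq0; apply/eqP.
congr (_ *m pev _ _).
have wC : (w%:C : K[i]) != 0 by rewrite fmorph_eq0.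
have wC1 : (w%:C + 1 : K[i]) != 0 by rewrite -(rmorph1 (real_complex K)) -rmorphD fmorph_eq0.
have -> : (((w + 1) / w) ^- n)%:C = (w%:C / (w%:C + 1)) ^+ n :> K[i].
  by rewrite -exprVn invf_div rmorphXn rmorphM fmorphV rmorphD rmorph1.
rewrite [_ \Po _]rmorphXn /= comp_polyB comp_polyZ comp_polyX.
rewrite -[X in X \Po _]/(1%:P) comp_polyC -exprZn; congr (_ ^+ n).
rewrite !fmorphV rmorphN fmorphV rmorphD rmorph1 /=.
apply/polyP => j; rewrite !(coefD, coefN, coefZ, coefX, coef1).
case: j => [|[|j]] /=; field; rewrite ?wC ?wC1 //.
Qed.

End Transformation.

Unset Implicit Arguments.
Set Strict Implicit.

Lemma pFq_term_two (K : realType) (N : nat) (A1 A2 B1 B2 P : 'M[K[i]]_N) (z : K[i])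
    (k : nat) : comm_mx A2 B1 ->
  pFq_term [:: P; A1; A2] [:: B1; B2] z k =
    z ^+ k *: (pochf P k *m (pochq A1 B1 k *m pochq A2 B2 k)).
Proof.
move=> AB; have cAB : invmx (poch B1 k) *m poch A2 k = poch A2 k *m invmx (poch B1 k).
  by apply/comm_mx_sym/comm_mx_inv/comm_poch.
rewrite /pFq_term !big_cons !big_nil !mulr1 -!/(_ *m _) /pochf -scalemxAl scalerA.
congr (_ *: _); rewrite /pochq -!/(_ *m _).
by rewrite -!mulmxA (mulmxA (invmx (poch B1 k))) cAB !mulmxA.
Qed.

Lemma pFq_two_one (K : realType) (N : nat) (A1 A2 B1 B2 : 'M[K[i]]_N) (m : nat) :
  comm_mx A2 B1 ->
  pFq [:: - (m%:R%:M); A1; A2] [:: B1; B2] 1 =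
    bintr (fun k => pochq A1 B1 k *m pochq A2 B2 k) m.
Proof.
move=> AB; apply: mcvg_lim.
have eig : (1%:M : 'M[K[i]]_N) *m (- (m%:R%:M) + m%:R%:M) = 0.
  by rewrite addNr mulmx0.
have := eigen_series (fun k => pochq A1 B1 k *m pochq A2 B2 k) 1 eig.
rewrite mul1mx rmorph1 scale1r; apply: mcvg_eq => n.
rewrite mul1mx; apply: eq_bigr => k _.
by rewrite pFq_term_two // !expr1n rmorph1.
Qed.

Theorem theorem2p4 (K : realType) (N : nat) (P Q R : 'M[K[i]]_N) (w : K)
    (PQ : P *m Q = Q *m P) (PR : P *m R = R *m P) (QR : Q *m R = R *m Q)
    (sQ : positive_stable Q) (sR : positive_stable R)
    (sRQ : positive_stable (R - Q))
    (w0 : w != 0) (w1 : w != -1) :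
  let num := [:: 2^-1 *: Q; 2^-1 *: (Q + 1%:M)] in
  let den := [:: 2^-1 *: R; 2^-1 *: (R + 1%:M)] in
  let z := ((w + 1)^-1)%:C in
  let rhs_term := fun m : nat =>
    (w%:C ^- m) *: (mbinN P m *m pFq (- (m%:R%:M) :: num) den 1) in
  [/\ 1 < `|w + 1| -> cvgn (series (pFq_term (P :: num) den z)),
      1 < `|w| -> cvgn (series rhs_term)
    & cvgn (series (pFq_term (P :: num) den z)) -> cvgn (series rhs_term) ->
      pFq (P :: num) den z =
        mpow (((w + 1) / w)%:C) P *m limn (series rhs_term)].
Proof.
move=> num den z rhs_term.
pose Q1 := 2^-1 *: Q; pose Q2 := 2^-1 *: (Q + 1%:M).
pose R1 := 2^-1 *: R; pose R2 := 2^-1 *: (R + 1%:M).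
have unit1 A (sA : positive_stable A) k : 2^-1 *: A + k%:R%:M \in unitmx.
  by have := half_shift_unit 0 k sA; rewrite raddf0 addr0.
have unit2 A (sA : positive_stable A) k : 2^-1 *: (A + 1%:M) + k%:R%:M \in unitmx.
  exact: (half_shift_unit 1 k sA).
have commZ (A B : 'M[K[i]]_N) : comm_mx A B -> comm_mx (2^-1 *: A) (2^-1 *: B).
  by move=> AB; rewrite /comm_mx -!scalemxAl -!scalemxAr AB.
have commQ1 : comm_mx (Q + 1%:M) R.
  exact/comm_mx_sym/(@comm_mx_shift _ _ _ _ 1)/comm_mx_sym.
have Q1R1 : comm_mx Q1 R1 by exact: commZ.
have Q2R1 : comm_mx Q2 R1 by exact: commZ.
have Q2R2 : comm_mx Q2 R2 by apply/commZ/(@comm_mx_shift _ _ _ _ 1).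
pose c k := pochq Q1 R1 k *m pochq Q2 R2 k.
pose d k := pochq R2 Q2 k *m pochq R1 Q1 k.
have cd k : c k *m d k = 1%:M.
  rewrite /c /d -mulmxA (mulmxA (pochq Q2 R2 k)) pochqK ?mul1mx ?pochqK //.
  - exact: unit1.
  - exact: unit1.
  - exact: unit2.
  - exact: unit2.
have subM (u v : nat -> 'M[K[i]]_N) : subexp (fun k => l1 (u k)) ->
    subexp (fun k => l1 (v k)) -> subexp (fun k => l1 (u k *m v k)).
  move=> su sv; apply: (subexp_le (fun k => l1M (u k) (v k))).
  exact: (subexpM (fun k => l1_ge0 (u k)) (fun k => l1_ge0 (v k))).
have sc : subexp (fun k => l1 (c k)).
  by apply: subM; apply: pochq_subexp; [exact: unit1|exact: unit2].
have sd : subexp (fun k => l1 (d k)).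
  by apply: subM; apply: pochq_subexp; [exact: unit2|exact: unit1].
have sa : subexp (fun k => l1 (bintr c k)).
  by apply: bintr_poch_subexp => //; [exact: unit1|exact: unit2].
have lhsE k : pFq_term (P :: num) den z k =
    ((w + 1)^-1 ^+ k)%:C *: (pochf P k *m c k).
  by rewrite pFq_term_two // rmorphXn.
have rhsE m : rhs_term m = ((- w^-1) ^+ m)%:C *: (pochf P m *m bintr c m).
  rewrite /rhs_term pFq_two_one // /mbinN /pochf -!scalemxAl !scalerA.
  congr (_ *: _).
  have -> : ((- w^-1) ^+ m)%:C = w%:C ^- m * (-1) ^+ m :> K[i].
    by rewrite (exprNn w^-1) exprVn rmorphM fmorphV !rmorphXn rmorphN rmorph1 mulrC.
  by rewrite mulrA.
split=> [wz|wz|].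
- apply: (subexp_pow_cvgn _ (pochf_subexp P sc) lhsE).
  by rewrite normfV invf_lt1 // (lt_trans _ wz).
- apply: (subexp_pow_cvgn _ (pochf_subexp P sa) rhsE).
  by rewrite normrN normfV invf_lt1 // (lt_trans _ wz).
move=> /cvgn_mcvg cF /cvgn_mcvg cG; rewrite /pFq.
have {}cF := mcvg_eq (fun n => eq_bigr _ (fun k _ => lhsE k)) cF.
have {}cG := mcvg_eq (fun n => eq_bigr _ (fun k _ => rhsE k)) cG.
have [wn|wp|w0'] := ltrgtP w 0; last by rewrite w0' eqxx in w0.
  have [wm|wm|w1'] := ltrgtP w (-1); last by rewrite w1' eqxx in w1.
    exact: (euler_neg w0 cF cG wm).
  by apply: (euler_terminating w0 cd sd cF cG); rewrite wm wn.
exact: (euler_pos w0 cF cG wp).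
Qed.
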